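(* Consider Non-IID Stochastic AdWords as in the context, and a fractional allocation $\mu^t_{ij}\ge0$ (for $t\in[T]$, $i\in I$, $j\in J$) such that $x^t_{ij}=f^t_i\mu^t_{ij}$ is a feasible solution of the Stochastic AdWords LP. Run the General SOCS for AdWords with this fractional allocation. For an agent $j$, let $y_j=\sum_t\sum_if^t_i\mu^t_{ij}b_{ij}/B_j$ and let $A_j$ be the total bid $b_{ij}$ of the items allocated to $j$. Then for every agent $j$, $$\mathbf{E}\Big[\Big(1-\frac{A_j}{B_j}\Big)^+\Big]\le g(y_j):=e^{-y_j}\Big(\frac34+\frac14\cdot\frac{1+(y_j-0.417)^+/4}{e^{(y_j-0.417)^+/4}}\Big)^2,$$ where the expectation is over the realized types and the algorithm's randomness.
   Context: Non-IID Stochastic AdWords: types $I$, agents $J$, $T$ steps; at each step $t$ independently an item of type $i$ arrives with probability $f^t_i$ ($\sum_if^t_i\le1$, otherwise no arrival); the algorithm observes the realized type and must allocate the item immediately. Agent $j$ has budget $B_j>0$ and bids $b_{ij}\ge0$ with $b_{ij}\le B_j$. Let $R^t_i$ indicate that the item at step $t$ has type $i$, and $\bar v_j(S)=\mathbf{E}[\min\{\sum_{(t,i)\in S}R^t_ib_{ij},B_j\}]$ for $S\subseteq[T]\times I$. Stochastic AdWords LP constraints: $\sum_jx^t_{ij}\le f^t_i$ for all $i,t$; $\sum_{(t,i)\in S}b_{ij}x^t_{ij}\le\bar v_j(S)$ for all $j$ and $S\subseteq[T]\times I$; $x\ge0$. Type Decomposition (type $i$ at step $t$): place in $[0,1)$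 consecutive left-closed right-open intervals $I_j$ of lengths $\mu^t_{ij}$ in a fixed order of $j$, leftover $I_\perp$ for a dummy agent $\perp$ with zero bids; sample $\eta$ uniform in $[0,\frac12)$, $\eta'=\eta+\frac12$, $\eta\in I_j$, $\eta'\in I_k$; output one-way type $i\sim j$ if $j=k$, else two-way type $i\sim\{j,k\}$. Two-Way SOCS for AdWords (stateful): on two-way type $i\sim\{j,k\}$: pick $m\in\{j,k\}$ uniformly; if $b_{im}\ge\frac23B_m$ mark step with $m$; if this is the second step marked with $m$, select opposite w.r.t. $m$ to the first marked step (select $m$ iff $m$ was not selected there); else select $j$ or $k$ uniformly. General SOCS for AdWords: each step draw a surrogate type by Type Decomposition (fresh randomness); allocate to $j$ for $i\sim j$; for $i\sim\{j,k\}$ allocate to the agent selected by the Two-Way SOCS. *)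

(* Defs.v *)
From HB Require Import structures.
From mathcomp Require Import all_boot all_order all_algebra.
From mathcomp Require Import all_classical all_reals all_analysis.

Set Implicit Arguments.
Unset Strict Implicit.
Unset Printing Implicit Defensive.

Import Order.TTheory GRing.Theory Num.Theory.

Local Open Scope classical_set_scope.
Local Open Scope ring_scope.

Definition pos_part (R : realType) (x : R) : R := Num.max x 0.

Definition mutually_independent (d : measure_display) (Omega : measurableType d)
    (R : realType) (P : probability Omega R) (K : finType)
    (F : K -> set (set Omega)) : Prop :=
  forall (A : {set K}) (E : K -> set Omega),
    (forall k, k \in A -> F k (E k)) ->
    P (\bigcap_(k in [set` A]) E k) = (\prod_(k in A) P (E k))%E.

Record adwords (R : realType) (I J : finType) (T : nat) := Adwords {
  arrival_prob : 'I_T -> I -> R;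
  bid : I -> J -> R;
  budget : J -> R;
  arrival_prob_ge0 : forall t i, 0 <= arrival_prob t i;
  arrival_prob_le1 : forall t, \sum_i arrival_prob t i <= 1;
  budget_gt0 : forall j, 0 < budget j;
  bid_ge0 : forall i j, 0 <= bid i j;
  bid_le_budget : forall i j, bid i j <= budget j
}.

Section Randomness.
Context (R : realType) (I J : finType) (T : nat) (W : adwords R I J T)
  (d : measure_display) (Omega : measurableType d) (P : probability Omega R).

(* [arr t] is the type realized at step [t], [None] meaning no arrival;
   [eta t] is the sample used by the type decomposition, [pick t] the choice of
   the agent m in {j, k} and [coin t] the uniform selection in {j, k}. *)
Definition step_events (arr : 'I_T -> Omega -> option I)
    (eta : 'I_T -> {RV P >-> R}) (pick coin : 'I_T -> {RV P >-> bool})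
    (k : 'I_T + 'I_T + 'I_T + 'I_T) : set (set Omega) :=
  match k with
  | inl (inl (inl t)) => preimage_set_system setT (arr t) setT
  | inl (inl (inr t)) => preimage_set_system setT (eta t) measurable
  | inl (inr t) => preimage_set_system setT (pick t) measurable
  | inr t => preimage_set_system setT (coin t) measurable
  end.

Record is_randomness (arr : 'I_T -> Omega -> option I)
    (eta : 'I_T -> {RV P >-> R}) (pick coin : 'I_T -> {RV P >-> bool}) : Prop :=
  IsRandomness {
  arr_measurable : forall t (o : option I), measurable (arr t @^-1` [set o]);
  arr_law : forall t i,
    P (arr t @^-1` [set Some i]) = (arrival_prob W t i)%:E;
  (* uniform on [0, 1/2) *)
  eta_law : forall t (B : set R), measurable B ->
    P (eta t @^-1` B) = (2%:E * lebesgue_measure (B `&` `[0%R, (2^-1)%R[%classic))%E;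
  pick_law : forall t, P (pick t @^-1` [set true]) = (2^-1)%:E;
  coin_law : forall t, P (coin t @^-1` [set true]) = (2^-1)%:E;
  steps_independent : mutually_independent P (step_events arr eta pick coin)
}.

Definition capped_bid (arr : 'I_T -> Omega -> option I) (j : J)
    (S : {set 'I_T * I}) (w : Omega) : R :=
  Num.min (\sum_(s in S) (arr s.1 w == Some s.2)%:R * bid W s.2 j) (budget W j).

Definition vbar (arr : 'I_T -> Omega -> option I) (j : J)
    (S : {set 'I_T * I}) : \bar R :=
  'E_P[capped_bid arr j S]%E.

Record lp_feasible (arr : 'I_T -> Omega -> option I)
    (x : 'I_T -> I -> J -> R) : Prop := LpFeasible {
  lp_ge0 : forall t i j, 0 <= x t i j;
  lp_arrival : forall t i, \sum_j x t i j <= arrival_prob W t i;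
  lp_budget : forall j (S : {set 'I_T * I}),
    ((\sum_(s in S) bid W s.2 j * x s.1 s.2 j)%:E <= vbar arr j S)%E
}.

End Randomness.

Section Algorithm.
Context (R : realType) (I J : finType) (T : nat) (W : adwords R I J T).

(* Throughout, [None : option J] is the dummy agent. *)

Definition interval_start (ord : seq J) (m : J -> R) (j : J) : R :=
  \sum_(k <- take (index j ord) ord) m k.

(* The agent whose interval contains [x]; [None] on the leftover. *)
Definition agent_at (ord : seq J) (m : J -> R) (x : R) : option J :=
  [pick j | interval_start ord m j <= x < interval_start ord m j + m j].

(* The state lists, in chronological order, for each marked step the agent it
   is marked with and whether this agent was selected at that step. *)
Definition marks := seq (J * bool).

(* The dummy agent has zero bids, hence is never marked. *)
Definition two_way_socs (i : I) (j k : option J) (pick coin : bool) (M : marks) :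
    option J * marks :=
  let unif := if coin then j else k in
  let m := if pick then j else k in
  let other := if pick then k else j in
  match m with
  | Some a =>
      if 2 / 3 * budget W a <= bid W i a then
        let sel := match [seq e.2 | e <- M & e.1 == a] with
                   | [:: first_selected] => if first_selected then other else m
                   | _ => unif
                   end in
        (sel, rcons M (a, sel == m))
      else (unif, M)
  | None => (unif, M)
  end.

Definition general_socs_step (ord : seq J) (mu : 'I_T -> I -> J -> R) (t : 'I_T)
    (arrival : option I) (eta : R) (pick coin : bool) (M : marks) :
    option J * marks :=
  match arrival with
  | Some i =>
      let j := agent_at ord (mu t i) eta in
      let k := agent_at ord (mu t i) (eta + 2^-1) in
      if j == k then (j, M) else two_way_socs i j k pick coin M
  | None => (None, M)
  end.

Context (ord : seq J) (mu : 'I_T -> I -> J -> R) (Omega : Type)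
  (arr : 'I_T -> Omega -> option I) (eta : 'I_T -> Omega -> R)
  (pick coin : 'I_T -> Omega -> bool).

Definition socs_step (w : Omega) (M : marks) (t : 'I_T) : option J * marks :=
  general_socs_step ord mu t (arr t w) (eta t w) (pick t w) (coin t w) M.

Definition marks_before (w : Omega) (t : 'I_T) : marks :=
  foldl (fun M s => (socs_step w M s).2) [::] (take t (enum 'I_T)).

Definition allocated (w : Omega) (t : 'I_T) : option J :=
  (socs_step w (marks_before w t) t).1.

Definition allocated_bid (j : J) (w : Omega) : R :=
  \sum_(t < T) \sum_(i : I)
    ((arr t w == Some i) && (allocated w t == Some j))%:R * bid W i j.

Definition fractional_load (j : J) : R :=
  \sum_(t < T) \sum_(i : I) arrival_prob W t i * mu t i j * bid W i j / budget W j.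

End Algorithm.

Definition socs_bound (R : realType) (y : R) : R :=
  let z := pos_part (y - 417 / 1000) / 4 in
  expR (- y) * (3 / 4 + 1 / 4 * ((1 + z) / expR z)) ^+ 2.

(* Main.v *)
Require Import Defs.
From HB Require Import structures.
From mathcomp Require Import all_boot all_order all_algebra.
From mathcomp Require Import all_classical all_reals all_analysis.
From mathcomp Require Import measurable_realfun ring lra.

(* Fix the agent, let [b] denote bids divided by its budget, and let [y_t] be its
   expected fractional bid at step [t], with sum [y].  Conditionally on everything
   but the coins, the selections of the agent are independent fair bits, except for
   pairs of opposite bits; forgetting the pairs marked with other agents only
   increases the expectation of a convex function of the total bid.
   - Bounding [(1 - sum b)^+] by [prod (1 - b)] gives [prod (1 - y_t)], hence at
     most [exp (- y - sg / 2)] with [sg = sum y_t ^ 2].  The first two steps marked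
     with the agent have [b >= 2 / 3], so being opposite saves a factor [3 / 4] over
     being independent; this yields [3 / 4 + 1 / 4 * (1 + m) exp (- m)], where [m]
     is the weighted expected number of marked steps.
   - The sharper bound of [(1 - sum b)^+] by [prod (1 - b)] times the probability of
     at most one success, where an item of bid [b] succeeds with probability
     [min (1, b / (1 - b))], yields a factor [(1 + n) exp (- n)] with
     [n = sum x min (b, 1 - b)].
   The LP constraint on all pairs gives [y <= 1], so that the target saves at most
   [(y - 0.417)^2 / 64] over [exp (- y)]; on the pairs with [b >= 2 / 3] and
   [mu > 1 / 2] it gives [y <= 2 m + 2 n + 0.317 + 9 sg].  Hence one of [sg], [n],
   [m] is large enough. *)

Set Implicit Arguments.
Unset Strict Implicit.
Unset Printing Implicit Defensive.

Import Order.TTheory GRing.Theory Num.Theory.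

Local Open Scope ring_scope.

(** * Value of the selection process with partially forgotten marks *)

(* How far the marks of an agent have progressed.  [Known e] follows the first mark;
   [e] is stated from the viewpoint of the analysed agent, which is selected at the
   second marked step involving it iff [~~ e].  [Unknown] forgets [e]. *)
Variant phase := Fresh | Known of bool | Unknown | Done.

Variant effect (R J : Type) := Sure of R | Coin of R | Mark of J & R.

Definition upd (J : eqType) (s : J -> phase) (k : J) (v : phase) : J -> phase :=
  fun k' => if k' == k then v else s k'.

Lemma upd_same (J : eqType) (s : J -> phase) k v : upd s k v k = v.
Proof. by rewrite /upd eqxx. Qed.

Lemma upd_other (J : eqType) (s : J -> phase) k v k' :
  k' != k -> upd s k v k' = s k'.
Proof. by rewrite /upd => /negbTE ->. Qed.

Lemma upd_upd (J : eqType) (s : J -> phase) k v v' :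
  upd (upd s k v) k v' = upd s k v'.
Proof. by apply/funext => k'; rewrite /upd; case: eqP. Qed.

Lemma updC (J : eqType) (s : J -> phase) k k' v v' : k' != k ->
  upd (upd s k v) k' v' = upd (upd s k' v') k v.
Proof.
move=> kk'; apply/funext => l; rewrite /upd.
by case: (eqVneq l k') => // ->; rewrite (negbTE kk').
Qed.

Section Process.
Context (R : realType) (J : finType) (S : Type) (Y : finType).
Context (q : S -> Y -> R) (eff : Y -> effect R J).

Definition amount (x : effect R J) : R :=
  match x with Sure d => d | Coin d => d | Mark _ d => d end.

Definition sure_prob (x : effect R J) : R := if x is Sure _ then 1 else 2^-1.

Hypothesis q_ge0 : forall t y, 0 <= q t y.
Hypothesis q_sum1 : forall t, \sum_y q t y = 1.
Hypothesis amount_ge0 : forall y, 0 <= amount (eff y).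
Hypothesis amount_le1 : forall y, amount (eff y) <= 1.

(** The marked agent [k] need not be the analysed one. From [Unknown] the selection is a fresh fair
    bit, yet the phase still moves to [Done]. *)
Definition effect_value (v : (J -> phase) -> R -> R) (x : effect R J)
    (s : J -> phase) (A : R) : R :=
  match x with
  | Sure d => v s (A + d)
  | Coin d => (v s (A + d) + v s A) / 2
  | Mark k d =>
    match s k with
    | Fresh => (v (upd s k (Known true)) (A + d) + v (upd s k (Known false)) A) / 2
    | Known e => v (upd s k Done) (if e then A else A + d)
    | Unknown => (v (upd s k Done) (A + d) + v (upd s k Done) A) / 2
    | Done => (v s (A + d) + v s A) / 2
    end
  end.

Fixpoint value (l : seq S) (s : J -> phase) (A : R) : R :=
  if l is t :: l' then \sum_y q t y * effect_value (value l') (eff y) s A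
  else pos_part (1 - A).

(** * Convexity of the value and forgetting of marks *)

Lemma pos_part_convex (a b c d : R) : a <= b -> a <= c -> b + c = a + d ->
  pos_part (1 - b) + pos_part (1 - c) <= pos_part (1 - a) + pos_part (1 - d).
Proof.
rewrite /pos_part /Order.max => ab ac e.
by do 4! (case: ifP => [|/negbT]; rewrite -?leNgt => ?); lra.
Qed.

(** Convexity in [A], in four-point form; every transition averages translates of values, which
    preserves it. *)
Lemma value_convex l s (a b c d : R) : a <= b -> a <= c -> b + c = a + d ->
  value l s b + value l s c <= value l s a + value l s d.
Proof.
elim: l s a b c d => [|t l IH] s a b c d ab ac e; first exact: pos_part_convex.
rewrite /= -!big_split /=; apply: ler_sum => y _.
rewrite -!mulrDr; apply: ler_wpM2l; first exact: q_ge0.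
case: (eff y) => [g|g|k g] /=; first by apply: IH; lra.
  have := IH s a b c d ab ac e.
  by have := IH s (a + g) (b + g) (c + g) (d + g); lra.
case: (s k) => [|[]||].
- have := IH (upd s k (Known false)) a b c d ab ac e.
  by have := IH (upd s k (Known true)) (a + g) (b + g) (c + g) (d + g); lra.
- exact: IH.
- by apply: IH; lra.
- have := IH (upd s k Done) a b c d ab ac e.
  by have := IH (upd s k Done) (a + g) (b + g) (c + g) (d + g); lra.
- have := IH s a b c d ab ac e.
  by have := IH s (a + g) (b + g) (c + g) (d + g); lra.
Qed.

(** The bit carried by [Known] is read at most once, at the next step marked with [k], so averaging
    over it amounts to drawing it there. *)
Lemma value_unknown l s k A :
  value l (upd s k Unknown) A =
  (value l (upd s k (Known true)) A + value l (upd s k (Known false)) A) / 2.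
Proof.
elim: l s A => [|t l IH] s A /=; first by field.
rewrite mulrDl !mulr_suml -big_split /=; apply: eq_bigr => y _.
rewrite -!mulrA -mulrDr; congr (_ * _); rewrite -mulrDl.
case: (eff y) => [g|g|k' g] /=; rewrite ?IH; [by []|by field|].
have [->|kk'] := eqVneq k' k; first by rewrite !upd_same !upd_upd; field.
rewrite !upd_other //.
by case: (s k') => [|[]||]; rewrite ?(updC _ _ _ kk') ?IH; field.
Qed.

(** The two values part ways only at the next step marked with [k], of amount [g], where they
    continue from [A] and [A + g] in the same phase. By convexity the gap between these shrinks as
    [A] grows. *)
Lemma value_known_antitone l s k (A B : R) : A <= B ->
  value l (upd s k (Known true)) B + value l (upd s k (Known false)) A <=
  value l (upd s k (Known true)) A + value l (upd s k (Known false)) B.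
Proof.
elim: l s A B => [|t l IH] s A B AB /=; first lra.
rewrite -!big_split /=; apply: ler_sum => y _.
rewrite -!mulrDr; apply: ler_wpM2l; first exact: q_ge0.
have := amount_ge0 y; case: (eff y) => [g|g|k' g] /= g0.
- by apply: IH; lra.
- by have := IH s A B AB; have := IH s (A + g) (B + g); lra.
have [->|kk'] := eqVneq k' k.
  rewrite !upd_same !upd_upd.
  by have := @value_convex l (upd s k Done) A B (A + g) (B + g); lra.
rewrite !upd_other //.
case: (s k') => [|[]||]; rewrite ?(updC _ _ _ kk').
- have := IH (upd s k' (Known false)) A B AB.
  by have := IH (upd s k' (Known true)) (A + g) (B + g); lra.
- exact: IH.
- by apply: IH; lra.
- have := IH (upd s k' Done) A B AB.
  by have := IH (upd s k' Done) (A + g) (B + g); lra.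
- by have := IH s A B AB; have := IH s (A + g) (B + g); lra.
Qed.

(* Forgetting the outcome of a first marked step replaces an opposite pair of
   selections by two independent ones, which dominates in the convex order. *)
Lemma value_forget l s k A d : 0 <= d ->
  value l (upd s k (Known true)) (A + d) + value l (upd s k (Known false)) A <=
  value l (upd s k Unknown) (A + d) + value l (upd s k Unknown) A.
Proof.
move=> d0; rewrite !value_unknown.
by have := @value_known_antitone l s k A (A + d); lra.
Qed.

Definition forgotten (s : J -> phase) (k : J) : bool :=
  if s k is Known _ then false else true.

Lemma forgotten_upd s k v k' : forgotten s k' ->
  (if v is Known _ then false else true) -> forgotten (upd s k v) k'.
Proof. by rewrite /forgotten /upd; case: eqP => // _; case: v. Qed.

(** One [s'] serves both branches: once a first mark is forgotten, selection and rejection lead to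
    the same phases. *)
Lemma effect_value_forget l s x A : 0 <= amount x ->
  (forall k, forgotten s k) ->
  exists2 s', (forall k, forgotten s' k) &
  effect_value (value l) x s A <= sure_prob x * value l s' (A + amount x)
    + (1 - sure_prob x) * value l s' A.
Proof.
case: x => [g|g|k g] /= g0 sf.
- by exists s => //; lra.
- by exists s => //; lra.
have := sf k; rewrite /forgotten; case: (s k) => // _.
- exists (upd s k Unknown) => [k'|]; first exact: forgotten_upd.
  by have := @value_forget l s k A g; lra.
- by exists (upd s k Done) => [k'|]; [exact: forgotten_upd|lra].
- by exists s => //; lra.
Qed.

(** * Comparison with the weight of at most one success *)

Definition loss (t : S) : R :=
  \sum_y q t y * (sure_prob (eff y) * amount (eff y)).

(** For an item of bid [d], [1 - d] splits into [pos_part (1 - 2 * d)], the weight without success,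
    and [Num.min d (1 - d)], the weight with a success. *)
Definition hinge_loss (t : S) : R :=
  \sum_y q t y *
    (sure_prob (eff y) * Num.min (amount (eff y)) (1 - amount (eff y))).

Lemma sure_prob_bounds x : 0 <= sure_prob x <= 1.
Proof. by case: x => *; rewrite /sure_prob; lra. Qed.

Lemma hinge_loss_ge0 t : 0 <= hinge_loss t.
Proof.
apply: sumr_ge0 => y _; apply: mulr_ge0 => //; apply: mulr_ge0.
  by have /andP[] := sure_prob_bounds (eff y).
by rewrite le_min amount_ge0 /= subr_ge0 amount_le1.
Qed.

Lemma hinge_loss_le_loss t : hinge_loss t <= loss t.
Proof.
apply: ler_sum => y _; apply: ler_wpM2l => //; apply: ler_wpM2l.
  by have /andP[] := sure_prob_bounds (eff y).
by rewrite ge_min lexx.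
Qed.

Lemma loss_hinge_le1 t : 0 <= 1 - loss t - hinge_loss t.
Proof.
rewrite -{1}(q_sum1 t) /loss /hinge_loss -!sumrB; apply: sumr_ge0 => y _.
have := amount_ge0 y; have := amount_le1 y; have := q_ge0 t y.
have := sure_prob_bounds (eff y).
move: (amount _) (sure_prob _) (q t y) => d p qy /andP[p0 p1] qy0 d1 d0.
have md : Num.min d (1 - d) <= 1 - d by rewrite ge_min lexx orbT.
rewrite -{1}[qy]mulr1 -!mulrBr; apply: mulr_ge0 => //; nra.
Qed.

(* Weights of no success (first component) and of at most one success (second). *)
Fixpoint at_most_one (y n : S -> R) (l : seq S) : R * R :=
  if l is t :: l' then
    let: (p, r) := at_most_one y n l' in
    ((1 - y t - n t) * p, (1 - y t - n t) * r + n t * p)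
  else (1, 1).

Lemma at_most_one_ge0 (y n : S -> R) l : (forall t, 0 <= n t) ->
  (forall t, 0 <= 1 - y t - n t) ->
  0 <= (at_most_one y n l).1 <= (at_most_one y n l).2.
Proof.
move=> n0 c0; elim: l => [|t l] /=; first lra.
case: (at_most_one y n l) => p r /= /andP[p0 pr].
have := n0 t; have := c0 t; move: (1 - y t - n t) (n t) => c m c0t m0.
by apply/andP; split; nra.
Qed.

(** The bid [A] collected so far is treated as one single item, which either fails and leaves the
    weight [r], or succeeds and leaves only [p]. At [p = r = 1] this is [pos_part (1 - A)]. *)
Definition hinge (A p r : R) : R :=
  pos_part (1 - 2 * A) * r + Num.min A (pos_part (1 - A)) * p.

(** Splitting the item [A + d] into [A] and [d] can only raise the weight. The cases are whether [A]
    and [d] exceed one half. *)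
Lemma hinge_step A d p r : 0 <= A -> 0 <= d <= 1 -> 0 <= p <= r ->
  hinge (A + d) p r <=
  hinge A (pos_part (1 - 2 * d) * p)
    (pos_part (1 - 2 * d) * r + Num.min d (1 - d) * p).
Proof.
move=> A0 /andP[d0 d1] /andP[p0 pr]; rewrite /hinge /pos_part.
have [dh|dh] := leP d (2^-1); have [Ah|Ah] := leP A (2^-1).
- rewrite (@max_l _ _ (1 - 2 * A)) ?(@max_l _ _ (1 - 2 * d)); [|lra..].
  rewrite (@max_l _ _ (1 - A)) ?(@max_l _ _ (1 - (A + d))); [|lra..].
  rewrite (@min_l _ _ d) ?(@min_l _ _ A); [|lra..].
  have [Adh|Adh] := leP (A + d) (2^-1).
    rewrite max_l ?min_l; [|lra..].
    (* The gap between the two sides is [4 * (A * d) * (r - p)]. *)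
    have : 0 <= (A * d) * (r - p) by apply: mulr_ge0; [exact: mulr_ge0|lra].
    by lra.
  rewrite max_r ?min_r; [|lra..].
  have : 0 <= (1 - 2 * A) * (1 - 2 * d) * (r - p).
    by apply: mulr_ge0; [apply: mulr_ge0|]; lra.
  by lra.
- rewrite (@max_r _ _ (1 - 2 * A)) ?(@max_l _ _ (1 - 2 * d)); [|lra..].
  rewrite (@max_r _ _ (1 - 2 * (A + d))); last lra.
  have := mulr_ge0 (mulr_ge0 d0 (_ : 0 <= 2 * A - 1)) p0 => /(_ ltac:(lra)) H.
  have [A1|A1] := leP A 1; last first.
    rewrite (@max_r _ _ (1 - A)) ?(@max_r _ _ (1 - (A + d))); [|lra..].
    by rewrite (@min_r _ _ (A + d)) ?(@min_r _ _ A); lra.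
  rewrite (@max_l _ _ (1 - A)) ?(@min_r _ _ A); [|lra..].
  have [Ad1|Ad1] := leP (A + d) 1.
    by rewrite max_l ?(@min_r _ _ (A + d)); lra.
  have := mulr_ge0 (mulr_ge0 (_ : 0 <= 1 - A) (_ : 0 <= 1 - 2 * d)) p0.
  by rewrite max_r ?(@min_r _ _ (A + d)); lra.
- rewrite (@max_r _ _ (1 - 2 * d)) ?(@max_l _ _ (1 - 2 * A)); [|lra..].
  rewrite (@max_r _ _ (1 - 2 * (A + d))) ?(@min_r _ _ d); [|lra..].
  have H := mulr_ge0 (mulr_ge0 A0 (_ : 0 <= 2 * d - 1)) p0.
  have H1 := mulr_ge0 (mulr_ge0 (_ : 0 <= 1 - 2 * A) (_ : 0 <= 1 - d)) p0.
  have {}H := H ltac:(lra); have {}H1 := H1 ltac:(lra) ltac:(lra).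
  have [Ad1|Ad1] := leP (A + d) 1; first by rewrite max_l ?(@min_r _ _ (A + d)); lra.
  by rewrite max_r ?(@min_r _ _ (A + d)); lra.
rewrite (@max_r _ _ (1 - 2 * d)) ?(@max_r _ _ (1 - 2 * A)); [|lra..].
rewrite (@max_r _ _ (1 - 2 * (A + d))) ?(@max_r _ _ (1 - (A + d))); [|lra..].
by rewrite (@min_r _ _ (A + d)); lra.
Qed.

Lemma value_hinge l s A : 0 <= A -> (forall k, forgotten s k) ->
  value l s A <= hinge A (at_most_one loss hinge_loss l).1
    (at_most_one loss hinge_loss l).2.
Proof.
elim: l s A => [|t l IH] s A A0 sf.
  rewrite /= /hinge /pos_part; have [Ah|Ah] := leP A (2^-1).
    by rewrite !max_l ?min_l; lra.
  rewrite (@max_r _ _ (1 - 2 * A)); last lra.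
  have [A1|A1] := leP A 1; first by rewrite max_l ?min_r; lra.
  by rewrite max_r ?min_r; lra.
have cE : 1 - loss t - hinge_loss t =
    \sum_y q t y * (1 - sure_prob (eff y)
       + sure_prob (eff y) * pos_part (1 - 2 * amount (eff y))).
  rewrite -{1}(q_sum1 t) /loss /hinge_loss -!sumrB; apply: eq_bigr => y _.
  have := amount_ge0 y; have := amount_le1 y; move: (amount _) => d d1 d0.
  rewrite /pos_part; have [dh|dh] := leP d (2^-1).
    by rewrite max_l ?min_l; [ring|lra..].
  by rewrite max_r ?min_r; [ring|lra..].
have := at_most_one_ge0 l hinge_loss_ge0 loss_hinge_le1; rewrite /=.
move: IH; case: (at_most_one _ _ l) => p r /= IH pr; rewrite cE.
(* [hinge] is linear in its two weights, so the mean weights of the step can be traded for a mean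
   over its outcomes. *)
have -> : hinge A ((\sum_y q t y * (1 - sure_prob (eff y) +
     sure_prob (eff y) * pos_part (1 - 2 * amount (eff y)))) * p)
   ((\sum_y q t y * (1 - sure_prob (eff y) +
     sure_prob (eff y) * pos_part (1 - 2 * amount (eff y)))) * r +
     hinge_loss t * p) =
  \sum_y q t y * (sure_prob (eff y) *
      hinge A (pos_part (1 - 2 * amount (eff y)) * p)
       (pos_part (1 - 2 * amount (eff y)) * r
         + Num.min (amount (eff y)) (1 - amount (eff y)) * p)
     + (1 - sure_prob (eff y)) * hinge A p r).
  rewrite /hinge /hinge_loss !mulr_suml -big_split /= !mulr_sumr -big_split /=.
  by apply: eq_bigr => y _; ring.
apply: ler_sum => y _; apply: ler_wpM2l => //.
have [s' s'f le1] := @effect_value_forget l s (eff y) A (amount_ge0 y) sf.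
apply: le_trans le1 _; apply: lerD; apply: ler_wpM2l.
- by rewrite /sure_prob; case: (eff y) => *; lra.
- have dd : 0 <= amount (eff y) <= 1 by rewrite amount_ge0 amount_le1.
  apply: le_trans (hinge_step A0 dd pr).
  by apply: IH => //; apply: addr_ge0.
- by rewrite /sure_prob; case: (eff y) => *; lra.
- exact: IH.
Qed.

Lemma pos_part_sub (A d : R) : 0 <= A -> 0 <= d <= 1 ->
  pos_part (1 - (A + d)) <= pos_part (1 - A) * (1 - d).
Proof.
move=> A0 /andP[d0 d1]; rewrite /pos_part; have [A1|A1] := leP A 1; last first.
  by rewrite !max_r; lra.
have := mulr_ge0 A0 d0; rewrite (@max_l _ _ (1 - A)); last lra.
have [Ad|Ad] := leP (A + d) 1; first by rewrite max_l; lra.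
by have := mulr_ge0 (_ : 0 <= 1 - A) (_ : 0 <= 1 - d); rewrite max_r; lra.
Qed.

Lemma pos_part_ge0 (x : R) : 0 <= pos_part x.
Proof. by rewrite /pos_part le_max lexx orbT. Qed.

(** * The gain from opposite selections at the first two marks of an agent *)

Section MarkedAgent.
Variable a : J.

Definition marks_agent (x : effect R J) : bool :=
  if x is Mark k _ then k == a else false.

Hypothesis amount_marked : forall y, marks_agent (eff y) -> 2 / 3 <= amount (eff y).

(** The weight [1 - d / 2] is the contribution of a marked outcome to [1 - loss t], so subtracting
    it leaves exactly the unmarked outcomes. *)
Definition mark_loss (t : S) : R :=
  \sum_(y | marks_agent (eff y)) q t y * (1 - amount (eff y) / 2).

Definition forgotten_but (s : J -> phase) : Prop :=
  forall k, k != a -> forgotten s k.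

Lemma forgotten_but_upd s k v : forgotten_but s ->
  (if v is Known _ then false else true) -> forgotten_but (upd s k v).
Proof. by move=> sf vf k' /sf; move/forgotten_upd; apply. Qed.

(** The state [s'] is chosen before [v] and [A], so that one choice covers both possible results of
    a first mark with [a]. *)
Lemma effect_value_forget_but l s x : 0 <= amount x -> ~~ marks_agent x ->
  forgotten_but s ->
  exists2 s', forgotten_but s' &
  forall v A, effect_value (value l) x (upd s a v) A <=
    sure_prob x * value l (upd s' a v) (A + amount x)
    + (1 - sure_prob x) * value l (upd s' a v) A.
Proof.
case: x => [g|g|k g] /= g0 ka sf.
- by exists s => // *; lra.
- by exists s => // *; lra.
have := sf k ka; rewrite /forgotten; case E: (s k) => // _.
- exists (upd s k Unknown) => [|v A]; first exact: forgotten_but_upd.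
  rewrite upd_other // E !(updC _ _ _ ka) -!(updC _ _ _ ka).
  by have := @value_forget l (upd s a v) k A g; lra.
- exists (upd s k Done) => [|v A]; first exact: forgotten_but_upd.
  by rewrite upd_other // E !(updC _ _ _ ka); lra.
- by exists s => // v A; rewrite upd_other // E; lra.
Qed.

Definition survival (l : seq S) : R := \prod_(t <- l) (1 - loss t).

Lemma loss_le1 t : 0 <= 1 - loss t.
Proof. by have := loss_hinge_le1 t; have := hinge_loss_ge0 t; lra. Qed.

Lemma survival_ge0 l : 0 <= survival l.
Proof. by apply: prodr_ge0 => t _; exact: loss_le1. Qed.

Lemma survivalE t : 1 - loss t =
  \sum_y q t y * (1 - sure_prob (eff y) * amount (eff y)).
Proof.
rewrite -{1}(q_sum1 t) /loss -sumrB; apply: eq_bigr => y _; ring.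
Qed.

(** After the second mark with [a], and with the marks of other agents forgotten, the selections are
    independent and each step contributes its mean factor [1 - loss t]. *)
Lemma value_done l s A : 0 <= A -> forgotten_but s ->
  value l (upd s a Done) A <= pos_part (1 - A) * survival l.
Proof.
elim: l s A => [|t l IH] s A A0 sf; first by rewrite /survival big_nil mulr1.
rewrite /survival big_cons -/(survival l) /= survivalE mulrA mulr_sumr mulr_suml.
apply: ler_sum => y _; rewrite (mulrCA _ (q t y)) -mulrA.
apply: ler_wpM2l => //.
have dd : 0 <= amount (eff y) <= 1 by rewrite amount_ge0 amount_le1.
have /andP[p0 p1] := sure_prob_bounds (eff y).
have [s' s'f le1] : exists2 s', forgotten_but s' &
    effect_value (value l) (eff y) (upd s a Done) A <=
    sure_prob (eff y) * value l (upd s' a Done) (A + amount (eff y))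
    + (1 - sure_prob (eff y)) * value l (upd s' a Done) A.
  have [|nm] := boolP (marks_agent (eff y)); last first.
    have [s' s'f le1] := effect_value_forget_but l (amount_ge0 y) nm sf.
    by exists s'.
  case: (eff y) => //= k g /eqP ->; exists s => //.
  by rewrite upd_same; lra.
apply: le_trans le1 _.
have h1 : value l (upd s' a Done) (A + amount (eff y)) <=
    pos_part (1 - A) * (1 - amount (eff y)) * survival l.
  apply: le_trans (IH s' _ _ s'f) _; first by case/andP: dd => ? _; lra.
  by apply: ler_wpM2r; [exact: survival_ge0|exact: pos_part_sub].
have h2 := IH s' A A0 s'f.
have := ler_wpM2l p0 h1; have := @ler_wpM2l _ (1 - sure_prob (eff y)) _ _ _ h2.
by lra.
Qed.

Lemma mark_loss_ge0 t : 0 <= mark_loss t.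
Proof.
by apply: sumr_ge0 => y _; apply: mulr_ge0 => //; have := amount_le1 y; lra.
Qed.

Lemma survival_markE t : 1 - loss t - mark_loss t =
  \sum_(y | ~~ marks_agent (eff y))
     q t y * (1 - sure_prob (eff y) * amount (eff y)).
Proof.
rewrite survivalE (bigID (fun y => marks_agent (eff y))) /= /mark_loss.
rewrite addrAC -sumrB big1 ?add0r // => y.
by case: (eff y) => //= k d _; field.
Qed.

Lemma loss_mark_le1 t : 0 <= 1 - loss t - mark_loss t.
Proof.
rewrite survival_markE; apply: sumr_ge0 => y _; apply: mulr_ge0 => //.
have := sure_prob_bounds (eff y); have := amount_ge0 y; have := amount_le1 y.
by move: (sure_prob _) (amount _) => p d d1 d0 /andP[p0 p1]; nra.
Qed.

(** The left side averages over the result of a first mark of bid [b]. If a second mark follows, the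
    pair saves a factor [3 / 4]; the last quarter is therefore owed only on the weight without
    further marks. *)
Lemma value_pending l s A b : 0 <= A -> 2 / 3 <= b <= 1 -> forgotten_but s ->
  (value l (upd s a (Known true)) (A + b) + value l (upd s a (Known false)) A) / 2
  <= pos_part (1 - A) * (1 - b / 2) *
     (3 / 4 * survival l + 1 / 4 * (at_most_one loss mark_loss l).1).
Proof.
move=> A0 /andP[b23 b1]; have bb : 0 <= b <= 1 by lra.
elim: l s A A0 => [|t l IH] s A A0 sf.
  rewrite /survival big_nil /=.
  by have := @pos_part_sub A b A0 bb; have := pos_part_ge0 (1 - A); lra.
rewrite /survival big_cons -/(survival l) /=.
have := survival_ge0 l; have := value_done l.
have := at_most_one_ge0 l mark_loss_ge0 loss_mark_le1.
move: (survival l) IH; case: (at_most_one _ _ l) => p r /= om IH /andP[p0 pr] vd om0.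
have -> : pos_part (1 - A) * (1 - b / 2) * (3 / 4 * ((1 - loss t) * om) +
     1 / 4 * ((1 - loss t - mark_loss t) * p)) =
  pos_part (1 - A) * (1 - b / 2) * (3 / 4 * (mark_loss t * om)) +
  pos_part (1 - A) * (1 - b / 2) * ((1 - loss t - mark_loss t) *
    (3 / 4 * om + 1 / 4 * p)) by field.
rewrite survival_markE -big_split /= mulr_suml.
rewrite (bigID (fun y => marks_agent (eff y))) /=; apply: lerD.
  rewrite /mark_loss mulr_suml !mulr_sumr; apply: ler_sum => y ym.
  have -> (u : R) : q t y * u * om = om * (q t y * u) by ring.
  rewrite -mulrDr -mulrA !(mulrCA _ (q t y)); apply: ler_wpM2l => //.
  have := amount_marked ym; have := amount_le1 y; move: ym.
  case: (eff y) => //= k d /eqP -> d1 d23; rewrite !upd_same !upd_upd.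
  have h1 := vd s (A + b) _ sf; have {}h1 := h1 ltac:(lra).
  have h2 := vd s (A + d) _ sf; have {}h2 := h2 ltac:(lra).
  have dd : 0 <= d <= 1 by lra.
  have := ler_wpM2r om0 (pos_part_sub A0 bb).
  have := ler_wpM2r om0 (pos_part_sub A0 dd).
  have := mulr_ge0 (mulr_ge0 (pos_part_ge0 (1 - A)) om0)
    (_ : 0 <= 3 / 4 * ((1 - b / 2) * (1 - d / 2)) - (1 - b / 2 - d / 2)).
  (* Exactly one of the bids [b] and [d] is collected, whence the mean [1 - b / 2 - d / 2]. Equality
     holds at [b = d = 2 / 3], the marking threshold. *)
  have hh : 0 <= 3 / 4 * ((1 - b / 2) * (1 - d / 2)) - (1 - b / 2 - d / 2).
    by nra.
  by move=> /(_ hh); lra.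
rewrite mulr_suml !mulr_sumr; apply: ler_sum => y ynm.
have [s' s'f le1] := effect_value_forget_but l (amount_ge0 y) ynm sf.
suff h : (effect_value (value l) (eff y) (upd s a (Known true)) (A + b) +
    effect_value (value l) (eff y) (upd s a (Known false)) A) / 2 <=
    pos_part (1 - A) * (1 - b / 2) * ((1 - sure_prob (eff y) * amount (eff y)) *
    (3 / 4 * om + 1 / 4 * p)) by have := ler_wpM2l (q_ge0 t y) h; lra.
have dd : 0 <= amount (eff y) <= 1 by rewrite amount_ge0 amount_le1.
have /andP[q0 q1] := sure_prob_bounds (eff y).
have l1 := le1 (Known true) (A + b); have l2 := le1 (Known false) A.
have h2 := IH s' A A0 s'f.
have h1 := IH s' (A + amount (eff y)) _ s'f.
have {}h1 := h1 ltac:(by case/andP: dd => ? _; lra).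
have {}h1 := le_trans h1 (_ : _ <= pos_part (1 - A) * (1 - amount (eff y)) *
   ((1 - b / 2) * (3 / 4 * om + 1 / 4 * p))).
have {}h1 := h1 ltac:(rewrite -mulrA; apply: ler_wpM2r;
   [apply: mulr_ge0; lra|exact: pos_part_sub]).
have := ler_wpM2l q0 h1; have := @ler_wpM2l _ (1 - sure_prob (eff y)) _ _ _ h2.
have -> : A + amount (eff y) + b = A + b + amount (eff y) by ring.
by lra.
Qed.

(** As for [value_pending], one mark earlier: the last quarter is owed on the weight of at most one
    mark. *)
Lemma value_fresh l s A : 0 <= A -> forgotten_but s ->
  value l (upd s a Fresh) A <= pos_part (1 - A) *
     (3 / 4 * survival l + 1 / 4 * (at_most_one loss mark_loss l).2).
Proof.
elim: l s A => [|t l IH] s A A0 sf.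
  by rewrite /survival big_nil /=; lra.
rewrite /survival big_cons -/(survival l) /=.
have := survival_ge0 l; have := value_pending l.
have := at_most_one_ge0 l mark_loss_ge0 loss_mark_le1.
move: (survival l) IH; case: (at_most_one _ _ l) => p r /= om IH /andP[p0 pr] vp om0.
have -> : pos_part (1 - A) * (3 / 4 * ((1 - loss t) * om) +
     1 / 4 * ((1 - loss t - mark_loss t) * r + mark_loss t * p)) =
  pos_part (1 - A) * (mark_loss t * (3 / 4 * om + 1 / 4 * p)) +
  pos_part (1 - A) * ((1 - loss t - mark_loss t) *
    (3 / 4 * om + 1 / 4 * r)) by field.
rewrite survival_markE.
rewrite (bigID (fun y => marks_agent (eff y))) /=; apply: lerD.
  rewrite /mark_loss mulr_suml !mulr_sumr; apply: ler_sum => y ym.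
  rewrite -mulrA !(mulrCA _ (q t y)); apply: ler_wpM2l => //.
  have := amount_marked ym; have := amount_le1 y; move: ym.
  case: (eff y) => //= k d /eqP -> d1 d23; rewrite !upd_same !upd_upd.
  by rewrite mulrA; apply: vp => //; lra.
rewrite mulr_suml !mulr_sumr; apply: ler_sum => y ynm.
have [s' s'f le1] := effect_value_forget_but l (amount_ge0 y) ynm sf.
rewrite -!mulrA !(mulrCA _ (q t y)); apply: ler_wpM2l => //.
have dd : 0 <= amount (eff y) <= 1 by rewrite amount_ge0 amount_le1.
have /andP[q0 q1] := sure_prob_bounds (eff y).
apply: le_trans (le1 Fresh A) _.
have h2 := IH s' A A0 s'f.
have h1 := IH s' (A + amount (eff y)) _ s'f.
have {}h1 := h1 ltac:(by case/andP: dd => ? _; lra).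
have {}h1 := le_trans h1 (_ : _ <= pos_part (1 - A) * (1 - amount (eff y)) *
   (3 / 4 * om + 1 / 4 * r)).
have {}h1 := h1 ltac:(apply: ler_wpM2r; [lra|exact: pos_part_sub]).
have := ler_wpM2l q0 h1; have := @ler_wpM2l _ (1 - sure_prob (eff y)) _ _ _ h2.
by lra.
Qed.

End MarkedAgent.
End Process.

(** * Elementary inequalities *)

Section Inequalities.
Import numFieldNormedType.Exports.
Context (R : realType).
Implicit Types x y z u v : R.

Lemma is_derive_ge0_le (f g : R -> R) x y : x <= y ->
  (forall u, is_derive u (1 : R) f (g u)) ->
  (forall u, x <= u <= y -> 0 <= g u) -> f x <= f y.
Proof.
move=> xy df g0.
apply: (@ger0_derive1_ndecr R f x y) => //.
- move=> u; rewrite in_itv /= => /andP[xu uy].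
  by rewrite derive1E (@derive_val _ _ _ _ _ _ _ (df u)); apply: g0; lra.
- apply: derivable_within_continuous => u _; exact: (@ex_derive _ _ _ _ _ _ _ (df u)).
Qed.

Lemma is_derive_expRN u : is_derive u (1 : R) (fun z => expR (- z)) (- expR (- u)).
Proof.
rewrite (_ : - expR (- u) = expR (- u) * (-1)); last by ring.
exact: (@is_derive1_comp R expR (fun z => - z)).
Qed.

(** The first diagonal Pade approximant of the exponential, in the form required by
    [at_most_one_poisson]. *)
Lemma expRN_ge_pade u : 0 <= u -> 1 - u / 2 <= expR (- u) * (1 + u / 2).
Proof.
move=> u0; rewrite -subr_ge0.
pose f := fun z : R => expR (- z) * (1 + z / 2) - (1 - z / 2).
have -> : 0 = f 0 by rewrite /f oppr0 expR0; field.
apply: (@is_derive_ge0_le f (fun z => (1 - expR (- z) * (1 + z)) / 2)) => //.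
  move=> z; have ? := is_derive_expRN z; rewrite /f.
  by apply: is_derive_eq; rewrite /GRing.scale /=; field.
move=> z /andP[z0 _]; apply: divr_ge0 => //; rewrite subr_ge0.
rewrite -ler_pdivlMl ?expR_gt0 // mulr1 expRN invrK; exact: expR_ge1Dx.
Qed.

Lemma expRN_le_taylor z : 0 <= z ->
  (1 + z) * expR (- z) <= 1 - z ^+ 2 / 2 + z ^+ 3 / 3.
Proof.
move=> z0; rewrite -subr_ge0.
pose f := fun z : R => 1 - z ^+ 2 / 2 + z ^+ 3 / 3 - (1 + z) * expR (- z).
have -> : 0 = f 0 by rewrite /f oppr0 expR0; field.
apply: (@is_derive_ge0_le f (fun z => z * (expR (- z) - (1 - z)))) => //.
  move=> u; have ? := is_derive_expRN u; rewrite /f.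
  by apply: is_derive_eq; rewrite /GRing.scale /=; field.
move=> u /andP[u0 _]; apply: mulr_ge0 => //.
by have := expR_ge1Dx (- u); lra.
Qed.

Lemma expRN_ge_taylor z : 0 <= z -> 1 - z ^+ 2 / 2 <= (1 + z) * expR (- z).
Proof.
move=> z0; rewrite -subr_ge0.
pose f := fun z : R => (1 + z) * expR (- z) - (1 - z ^+ 2 / 2).
have -> : 0 = f 0 by rewrite /f oppr0 expR0; field.
apply: (@is_derive_ge0_le f (fun z => z * (1 - expR (- z)))) => //.
  move=> u; have ? := is_derive_expRN u; rewrite /f.
  by apply: is_derive_eq; rewrite /GRing.scale /=; field.
by move=> u /andP[u0 _]; apply: mulr_ge0 => //; rewrite subr_ge0 expR_le1; lra.
Qed.

Lemma expRN_antitone x y : 0 <= x -> x <= y ->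
  (1 + y) * expR (- y) <= (1 + x) * expR (- x).
Proof.
move=> x0 xy; rewrite -lerN2.
apply: (@is_derive_ge0_le (fun z => - ((1 + z) * expR (- z)))
   (fun z => z * expR (- z))) => //.
  move=> u; have ? := is_derive_expRN u.
  by apply: is_derive_eq; rewrite /GRing.scale /=; field.
by move=> u /andP[u0 _]; apply: mulr_ge0; [lra|exact: expR_ge0].
Qed.

Lemma expR_ge_quadratic v : 0 <= v -> 1 + v + v ^+ 2 / 2 <= expR v.
Proof.
move=> v0; rewrite -subr_ge0.
pose f := fun z : R => expR z - (1 + z + z ^+ 2 / 2).
have -> : 0 = f 0 by rewrite /f expR0; field.
apply: (@is_derive_ge0_le f (fun z => expR z - (1 + z))) => //.
  move=> u; have ? := is_derive_expR u; rewrite /f.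
  by apply: is_derive_eq; rewrite /GRing.scale /=; field.
by move=> u _; rewrite subr_ge0; exact: expR_ge1Dx.
Qed.

(** The quadratic term makes a spread [sg] worth a factor [expR (- (sg / 2))]. *)
Lemma onem_le_expRN y : 0 <= y -> 1 - y <= expR (- (y + y ^+ 2 / 2)).
Proof.
move=> y0; rewrite expRN -[leRHS]mul1r ler_pdivlMr ?expR_gt0 //.
rewrite -subr_ge0.
pose f := fun z : R => 1 - (1 - z) * expR (z + z ^+ 2 / 2).
have -> : 0 = f 0 by rewrite /f !expr0n /= mul0r addr0 expR0; ring.
apply: (@is_derive_ge0_le f (fun z => z ^+ 2 * expR (z + z ^+ 2 / 2))) => //.
  move=> u.
  have h : is_derive u (1 : R) (fun z : R => z + z ^+ 2 / 2) (1 + u).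
    by apply: is_derive_eq; rewrite /GRing.scale /=; field.
  have ? := @is_derive1_comp R expR (fun z : R => z + z ^+ 2 / 2) u _ _
    (is_derive_expR _) h.
  by rewrite /f; apply: is_derive_eq; rewrite /GRing.scale /=; field.
by move=> u _; apply: mulr_ge0; [exact: sqr_ge0|exact: expR_ge0].
Qed.

Lemma expRN_le_onem v : 0 <= v <= 1 / 3 -> expR (- (v + v ^+ 2)) <= 1 - v.
Proof.
move=> /andP[v0 v1]; rewrite expRN -[leLHS]mul1r ler_pdivrMr ?expR_gt0 //.
have h := @expR_ge_quadratic (v + v ^+ 2) _.
have {}h := h ltac:(nra).
apply: (@le_trans _ _ ((1 - v) * (1 + (v + v ^+ 2) + (v + v ^+ 2) ^+ 2 / 2))).
  suff : 0 <= v ^+ 2 * (1 / 2 * (1 - v * (1 + v + v ^+ 2))) by lra.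
  by apply: mulr_ge0; [exact: sqr_ge0|nra].
by apply: ler_wpM2l => //; lra.
Qed.

Lemma expRN_le_quadratic v : 0 <= v -> expR (- v) <= 1 - v + v ^+ 2 / 2.
Proof.
move=> v0; rewrite -subr_ge0.
pose f := fun z : R => 1 - z + z ^+ 2 / 2 - expR (- z).
have -> : 0 = f 0 by rewrite /f oppr0 expR0; field.
apply: (@is_derive_ge0_le f (fun z => expR (- z) - (1 - z))) => //.
  move=> u; have ? := is_derive_expRN u; rewrite /f.
  by apply: is_derive_eq; rewrite /GRing.scale /=; field.
by move=> u _; have := expR_ge1Dx (- u); lra.
Qed.

Lemma expRN_ge_cubic v : 0 <= v -> 1 - v + v ^+ 2 / 2 - v ^+ 3 / 6 <= expR (- v).
Proof.
move=> v0; rewrite -subr_ge0.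
pose f := fun z : R => expR (- z) - (1 - z + z ^+ 2 / 2 - z ^+ 3 / 6).
have -> : 0 = f 0 by rewrite /f oppr0 expR0; field.
apply: (@is_derive_ge0_le f (fun z => 1 - z + z ^+ 2 / 2 - expR (- z))) => //.
  move=> u; have ? := is_derive_expRN u; rewrite /f.
  by apply: is_derive_eq; rewrite /GRing.scale /=; field.
by move=> u /andP[u0 _]; rewrite subr_ge0; exact: expRN_le_quadratic.
Qed.

Lemma expRN_7_10_ge : 99 / 200 <= expR (- (7 / 10) : R).
Proof.
(* Halving the argument makes the cubic Taylor bound sharp enough; at [7 / 10] itself it falls below
   [99 / 200]. *)
have -> : - (7 / 10) = - (7 / 20) + - (7 / 20) :> R by field.
rewrite expRD; have := @expRN_ge_cubic (7 / 20) _ => /(_ ltac:(lra)).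
move: (expR _) => e h; have he : 88 / 125 <= e by lra.
by nra.
Qed.

(* The maximum of [2 (1 - exp (- u)) - u] is [1 - ln 2]; the constant here
   comes from the tangent at [u = 7 / 10]. *)
Lemma double_coverage_le u : 0 <= u -> 2 * (1 - expR (- u)) - u <= 317 / 1000.
Proof.
move=> u0.
have -> : - u = - (7 / 10) + (7 / 10 - u) by ring.
rewrite expRD; have := expR_ge1Dx (7 / 10 - u); have := expRN_7_10_ge.
have := expR_gt0 (- (7 / 10) : R); have := expR_gt0 (7 / 10 - u).
(* The tangent [1 + (7 / 10 - u)] is nonnegative up to [u = 17 / 10]; beyond, [2 - u] is already
   below the constant. *)
by move: (expR _) (expR (_ - _)) => e1 e2 *; have [|] := leP u (17 / 10); nra.
Qed.

(** Apply [double_coverage_le] with [u] the sum of [f t + f t ^+ 2]: each [1 - f t] is at least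
    [expR (- (f t + f t ^+ 2))], and the squares become the error term. *)
Lemma coverage_excess_le (S : Type) (l : seq S) (f : S -> R) :
  (forall t, 0 <= f t <= 1 / 3) ->
  2 * (1 - \prod_(t <- l) (1 - f t)) - \sum_(t <- l) f t <=
  317 / 1000 + \sum_(t <- l) f t ^+ 2.
Proof.
move=> f13.
have s0 : 0 <= \sum_(t <- l) (f t + f t ^+ 2).
  by apply: sumr_ge0 => t _; have /andP[? _] := f13 t; nra.
have h : expR (- \sum_(t <- l) (f t + f t ^+ 2)) <= \prod_(t <- l) (1 - f t).
  elim: l {s0} => [|t l IH]; first by rewrite !big_nil oppr0 expR0.
  rewrite !big_cons opprD expRD; apply: ler_pM; rewrite ?expR_ge0 //.
  exact: expRN_le_onem.
by have := double_coverage_le s0; rewrite big_split /= in h *; lra.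
Qed.

Lemma prod_onem_le (S : Type) (l : seq S) (y : S -> R) :
  (forall t, 0 <= y t <= 1) ->
  \prod_(t <- l) (1 - y t) <=
  expR (- \sum_(t <- l) y t) * expR (- (\sum_(t <- l) y t ^+ 2 / 2)).
Proof.
move=> y01; elim: l => [|t l IH]; first by rewrite !big_nil oppr0 expR0 mulr1.
rewrite !big_cons !opprD !expRD.
have -> (a b c d : R) : a * b * (c * d) = (a * c) * (b * d) by ring.
have /andP[y0 y1] := y01 t.
apply: ler_pM => //; first lra.
  by apply: prodr_ge0 => s _; have := y01 s; lra.
by rewrite -expRD -opprD; exact: onem_le_expRN.
Qed.

(* Splitting a step into infinitesimal ones only increases the probability of at
   most one success, as long as [n t <= y t]. *)
Lemma at_most_one_poisson (S : Type) (l : seq S) (y n : S -> R) :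
  (forall t, 0 <= n t <= y t) -> (forall t, 0 <= 1 - y t - n t) ->
  (at_most_one y n l).1 <= expR (- \sum_(t <- l) (y t + n t)) /\
  (at_most_one y n l).2 <=
    expR (- \sum_(t <- l) (y t + n t)) * (1 + \sum_(t <- l) n t).
Proof.
move=> ny c0; elim: l => [|t l] /=.
  by rewrite !big_nil oppr0 expR0; split; lra.
have n0 s : 0 <= n s by have /andP[] := ny s.
have := @at_most_one_ge0 R S y n l n0 c0.
case: (at_most_one y n l) => p r /= /andP[p0 pr] [IHp IHr].
rewrite !big_cons opprD expRD; set E := expR (- \sum_(_ <- _) _) in IHp IHr *.
set N := \sum_(_ <- _) _ in IHr *.
have := c0 t; have := ny t; move: (y t) (n t) => yt nt /andP[nt0 nty] ct.
have pade := @expRN_ge_pade (yt + nt) _; have {}pade := pade ltac:(lra).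
have ge1 := expR_ge1Dx (- (yt + nt)).
have e0 := expR_gt0 (- (yt + nt)).
have e1 : expR (- (yt + nt)) <= 1 by rewrite expR_le1; lra.
move: (expR _) pade ge1 e0 e1 => e pade ge1 e0 e1.
have E0 : 0 <= E by apply: le_trans p0 _.
split; first by apply: ler_pM => //; lra.
have h1 : (1 - yt - nt) * r + nt * p <= e * (r + nt * p).
  have : 0 <= (e - (1 - yt - nt)) * (r - p) by apply: mulr_ge0; lra.
  (* As [nt <= yt], the last [nt] can be replaced by half of [yt + nt]; what remains is the Pade
     bound. *)
  have : 0 <= p * (e - 1 + (yt + nt) - nt * (1 - e)).
    apply: mulr_ge0 => //.
    have : 0 <= (yt - nt) * (1 - e) by apply: mulr_ge0; lra.
    by lra.
  by lra.
apply: le_trans h1 _; rewrite -mulrA; apply: ler_wpM2l; first lra.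
have := ler_wpM2l nt0 IHp; lra.
Qed.

Lemma at_most_one_le_prod (S : Type) (l : seq S) (y n : S -> R) :
  (forall t, 0 <= n t) -> (forall t, 0 <= 1 - y t - n t) ->
  (at_most_one y n l).2 <= \prod_(t <- l) (1 - y t).
Proof.
move=> n0 c0; elim: l => [|t l] /=; first by rewrite big_nil.
have := @at_most_one_ge0 R S y n l n0 c0.
case: (at_most_one y n l) => p r /= /andP[p0 pr] IH; rewrite big_cons.
have := n0 t; have := c0 t; move: (n t) (y t) => nt yt ct nt0.
apply: (@le_trans _ _ ((1 - yt) * r)); first by nra.
by apply: ler_wpM2l => //; lra.
Qed.

(** * Comparison of the gains with the target function *)

Lemma socs_bound_ge y : 417 / 1000 <= y ->
  expR (- y) * (1 - (y - 417 / 1000) ^+ 2 / 64) <= socs_bound y.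
Proof.
move=> y1; rewrite /socs_bound /pos_part max_l; last lra.
apply: ler_wpM2l; first exact: expR_ge0.
set z := (y - 417 / 1000) / 4; have z0 : 0 <= z by rewrite /z; lra.
have -> : (y - 417 / 1000) ^+ 2 / 64 = z ^+ 2 / 4 by rewrite /z; field.
have := expRN_ge_taylor z0; rewrite expRN; move: (_ / expR z) => Q hQ.
(* The bound to reach is [1 - z ^+ 2 / 4]. It is at most the square of [1 - z ^+ 2 / 8], and
   negative when [z ^+ 2 > 4]. *)
have [z2|z2] := leP (z ^+ 2) 4.
  apply: (@le_trans _ _ ((1 - z ^+ 2 / 8) ^+ 2)).
    by have := sqr_ge0 (z ^+ 2 / 8); lra.
  by rewrite ler_sqr ?nnegrE; lra.
by apply: le_trans (sqr_ge0 _); lra.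
Qed.

Lemma socs_bound_small y : y <= 417 / 1000 -> socs_bound y = expR (- y).
Proof.
move=> y1; rewrite /socs_bound /pos_part max_r; last lra.
by rewrite mul0r expR0 invr1; field.
Qed.

(** A positive [sg] lowers [m], but through [m ^+ 2] this costs only about [0.22 * sg], less than
    the [0.37 * sg] or so that it saves directly. The range of [D] ends at [1 - 417 / 1000]. *)
Lemma pairing_gain (D sg m : R) : 0 <= D <= 583 / 1000 -> 0 <= sg <= 63 / 2000 * D ^+ 2 ->
  m = 399 / 1000 * D - 9 / 2 * sg -> 0 <= m ->
  3 / 4 * (1 - sg / 2 + (sg / 2) ^+ 2 / 2) + 1 / 4 * (1 - m ^+ 2 / 2 + m ^+ 3 / 3)
  <= 1 - D ^+ 2 / 64.
Proof.
move=> /andP[D0 D1] /andP[sg0 sgD] mE m0.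
have D2 : D ^+ 2 <= 17 / 50 by nra.
have sg2 : sg ^+ 2 <= 11 / 1000 * sg by nra.
have Dsg : D * sg <= 583 / 1000 * sg by apply: ler_wpM2r.
have m2 : 399 / 1000 * (399 / 1000) * D ^+ 2 - 21 / 10 * sg <= m ^+ 2.
  by rewrite mE; have := sqr_ge0 sg; lra.
have m3 : m ^+ 3 <= 233 / 1000 * m ^+ 2.
  by rewrite exprS; apply: ler_wpM2r; [exact: sqr_ge0|rewrite mE; lra].
clear mE m0 Dsg D1 D0; move: (m ^+ 2) (m ^+ 3) m2 m3 => u w m2 m3.
by move: D2 sgD m2; move: (D ^+ 2) => v *; lra.
Qed.

(** The quadratic term alone would need a slope of [1 / sqrt 32], about [0.177]; the margin up to
    [0.186] pays for the cubic term. *)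
Lemma hinge_gain (D : R) : 0 <= D <= 583 / 1000 ->
  1 - (93 / 500 * D) ^+ 2 / 2 + (93 / 500 * D) ^+ 3 / 3 <= 1 - D ^+ 2 / 64.
Proof.
move=> /andP[D0 D1].
have : D ^+ 3 <= 583 / 1000 * D ^+ 2.
  by rewrite exprS; apply: ler_wpM2r => //; exact: sqr_ge0.
by have := sqr_ge0 D; clear; lra.
Qed.

(** If the last hypothesis fails, the factor [expR (- (sg / 2))] alone meets the target. To first
    order the bound is [D ^+ 2 / 32]; [63 / 2000] slightly exceeds [1 / 32]. *)
Lemma spread_le (D sg : R) : 0 <= D <= 583 / 1000 -> 0 <= sg ->
  1 - D ^+ 2 / 64 < expR (- (sg / 2)) -> sg <= 63 / 2000 * D ^+ 2.
Proof.
move=> /andP[D0 D1] sg0 h.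
have D2 : D ^+ 2 <= 17 / 50 by nra.
have e1 := expR_ge1Dx (sg / 2).
have e2 : expR (- (sg / 2)) * expR (sg / 2) = 1 by rewrite -expRD addNr expR0.
have e3 : (1 - D ^+ 2 / 64) * (1 + sg / 2) <= 1.
  by rewrite -[leRHS]e2; apply: ler_pM => //; lra.
clear e1 e2 h; move: (D ^+ 2) (sqr_ge0 D) D2 e3 => u *; nra.
Qed.

(** Here [om] stands for the survival weight, [sm] and [sn] for the weights of at most one mark and
    at most one success. Up to [417 / 1000] the target is [expR (- y)]; beyond, one of [sg], [n],
    [m] must yield the gain [D ^+ 2 / 64]. *)
Lemma le_socs_bound (E y sg n m om sm sn : R) :
  0 <= y <= 1 -> 0 <= sg -> 0 <= n -> 0 <= m ->
  E <= 3 / 4 * om + 1 / 4 * sm -> E <= sn -> sm <= om ->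
  om <= expR (- y) * expR (- (sg / 2)) ->
  sm <= expR (- y) * ((1 + m) * expR (- m)) ->
  sn <= expR (- y) * ((1 + n) * expR (- n)) ->
  (sg <= 1 / 81 -> y <= 2 * m + 2 * n + 317 / 1000 + 9 * sg) ->
  E <= socs_bound y.
Proof.
move=> /andP[y0 y1] sg0 n0 m0 Em En smom hom hsm hsn hy.
have ey0 := expR_gt0 (- y).
have Eom : E <= expR (- y) * expR (- (sg / 2)).
  by apply: le_trans Em (le_trans _ hom); clear -smom; lra.
have [yl|yl] := leP y (417 / 1000).
  rewrite (socs_bound_small yl); apply: le_trans Eom _.
  by rewrite ler_piMr ?(ltW ey0) // expR_le1; clear -sg0; lra.
apply: le_trans (socs_bound_ge (ltW yl)).
pose D := y - 417 / 1000; rewrite -/D.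
have D01 : 0 <= D <= 583 / 1000 by rewrite /D; clear -yl y1; lra.
have [h|h] := leP (expR (- (sg / 2))) (1 - D ^+ 2 / 64).
  by apply: le_trans Eom _; rewrite ler_pM2l.
have sgD := spread_le D01 sg0 h.
have [nD|nD] := leP (93 / 500 * D) n.
  have nD0 : 0 <= 93 / 500 * D by clear -D01; lra.
  apply: le_trans En _; apply: le_trans hsn _; rewrite ler_pM2l //.
  apply: le_trans (expRN_antitone nD0 nD) _.
  by apply: le_trans (expRN_le_taylor nD0) _; exact: hinge_gain.
have D2 : D ^+ 2 <= 17 / 50 by clear -D01; nra.
have {}hy : y <= 2 * m + 2 * n + 317 / 1000 + 9 * sg.
  by apply: hy; clear -sgD D2; lra.
(* Isolating [m] gives the slope [1 / 2 - 93 / 500] plus a constant [1 / 20], which is at least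
   [85 / 1000 * D] since [D <= 583 / 1000]. *)
have mD : 399 / 1000 * D - 9 / 2 * sg <= m.
  have : y = D + 417 / 1000 by rewrite /D; ring.
  by clear -nD hy D01; lra.
pose m1 := 399 / 1000 * D - 9 / 2 * sg; rewrite -/m1 in mD.
have m10 : 0 <= m1 by rewrite /m1; clear -D01 sgD; nra.
have h1 : expR (- (sg / 2)) <= 1 - sg / 2 + (sg / 2) ^+ 2 / 2.
  by apply: expRN_le_quadratic; clear -sg0; lra.
have h2 : (1 + m) * expR (- m) <= 1 - m1 ^+ 2 / 2 + m1 ^+ 3 / 3.
  by apply: le_trans (expRN_antitone m10 mD) _; exact: expRN_le_taylor.
have h3 : 3 / 4 * expR (- (sg / 2)) + 1 / 4 * ((1 + m) * expR (- m))
    <= 1 - D ^+ 2 / 64.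
  have sg01 : 0 <= sg <= 63 / 2000 * D ^+ 2 by rewrite sg0.
  apply: le_trans (pairing_gain D01 sg01 erefl m10).
  by apply: lerD; apply: ler_wpM2l => //; clear; lra.
apply: le_trans Em _; have := ler_wpM2l (ltW ey0) h3.
by clear -hom hsm; lra.
Qed.

End Inequalities.

(** * Outcomes of a step *)

Section Paths.
Context (R : realType) (K X : finType) (St : Type).
Context (w : K -> X -> R) (step : X -> St -> St) (G : St -> R).

Fixpoint path_value (l : seq K) (s : St) : R :=
  if l is t :: l' then \sum_x w t x * path_value l' (step x s) else G s.

(** Freezing the functions to [v] outside [l] lets the induction release one coordinate at a
    time. *)
Lemma sum_paths_agreeing (l : seq K) (v : {ffun K -> X}) (s : St) : uniq l ->
  \sum_(x : {ffun K -> X} | [forall t, (t \notin l) ==> (x t == v t)])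
     (\prod_t w t (x t)) * G (foldl (fun s t => step (x t) s) s l) =
  (\prod_(t | t \notin l) w t (v t)) * path_value l s.
Proof.
elim: l v s => [|t l IH] v s.
  move=> _; rewrite (big_pred1 v) //= => x; apply/forallP/eqP => [h|-> //].
  by apply/ffunP => t; apply/eqP; have := h t.
rewrite cons_uniq => /andP[tl ul].
rewrite (partition_big (fun x : {ffun K -> X} => x t) predT) //= mulr_sumr.
apply: eq_bigr => z _.
pose v' : {ffun K -> X} := [ffun u => if u == t then z else v u].
rewrite (eq_bigl (fun x : {ffun K -> X} =>
    [forall u, (u \notin l) ==> (x u == v' u)])); last first.
  move=> x; apply/andP/forallP.
    move=> [/forallP h /eqP xt] u; apply/implyP => ul'; rewrite ffunE.
    have [->|ut] := eqVneq u t; first by rewrite xt eqxx.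
    by have := h u; rewrite in_cons negb_or ut ul'.
  move=> h; split; last by have := h t; rewrite tl ffunE eqxx.
  apply/forallP => u; apply/implyP; rewrite in_cons negb_or => /andP[ut ul'].
  by have := h u; rewrite ul' ffunE (negbTE ut).
rewrite (eq_bigr (fun x : {ffun K -> X} => (\prod_t w t (x t)) *
    G (foldl (fun s t => step (x t) s) (step z s) l))); last first.
  move=> x /forallP h; have := h t; rewrite tl ffunE eqxx => /eqP -> //.
rewrite IH // mulrCA mulrA; congr (_ * _).
rewrite (bigD1 t) //= ffunE eqxx; congr (_ * _).
apply: eq_big => [u|u /andP[_ ut]]; last by rewrite ffunE (negbTE ut).
by rewrite in_cons negb_or andbC.
Qed.

Lemma sum_paths (s : St) :
  \sum_(x : {ffun K -> X})
     (\prod_t w t (x t)) * G (foldl (fun s t => step (x t) s) s (enum K)) =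
  path_value (enum K) s.
Proof.
have [v _|none] := pickP (fun _ : {ffun K -> X} => true).
  have h : \prod_(t | t \notin enum K) w t (v t) = 1.
    by apply: big1 => t; rewrite mem_enum.
  transitivity (1 * path_value (enum K) s); last by rewrite mul1r.
  rewrite -[X in X * path_value _ _]h.
  rewrite -sum_paths_agreeing ?enum_uniq //; apply: eq_bigl => x.
  by apply/esym/forallP => t; rewrite mem_enum.
(* Without any function, [X] is empty and [K] is not, so both sides vanish. *)
rewrite big_pred0 //; case E: (enum K) => [|t l] /=.
  have v : K -> X by move=> t; have := mem_enum K t; rewrite E.
  by have := none (finfun v).
rewrite big_pred0 // => x; by have := none [ffun=> x].
Qed.

End Paths.

(** * The outcome of a step as seen by one agent *)

Section Outcomes.
Context (R : realType) (I J : finType) (T : nat) (W : adwords R I J T) (a : J).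

(** The coin is kept apart because [effect_value] averages over it. *)
Definition outcome : Type := (option I * (option J * option J) * bool)%type.

Definition rel_bid (i : I) : R := bid W i a / budget W a.

(** The amount [d] is the bid of [a], while the marking test concerns the bid of [m]. A mark with
    [d = 0] is kept, as it still advances the phase of [m]. *)
Definition outcome_effect (y : outcome) : effect R J :=
  let: (o, (j, k), p) := y in
  if o is Some i then
    if j == k then Sure J (if j == Some a then rel_bid i else 0) else
    let d := if (j == Some a) || (k == Some a) then rel_bid i else 0 in
    if (if p then j else k) is Some m then
      if 2 / 3 * budget W m <= bid W i m then Mark m d else Coin J d
    else Coin J d
  else Sure J 0.

Definition outcome_step (x : outcome * bool) (M : marks J) : option J * marks J :=
  let: (o, (j, k), p, c) := x in
  if o is Some i then
    if j == k then (j, M) else two_way_socs W i j k p c M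
  else (None, M).

Definition outcome_gain (x : outcome * bool) (sel : option J) : R :=
  if x.1.1.1 is Some i then (sel == Some a)%:R * rel_bid i else 0.

(** The recorded bit says whether [k] was selected. For [k != a] it is reversed: [a], as the other
    candidate, is selected at the second step marked with [k] iff [k] was selected at the first. *)
Definition phase_of (M : marks J) (k : J) : phase :=
  match [seq e.2 | e <- M & e.1 == k] with
  | [::] => Fresh
  | [:: f] => Known ((k == a) == f)
  | _ => Done
  end.

Lemma phase_of_rcons M k f : phase_of (rcons M (k, f)) =
  upd (phase_of M) k
    (if phase_of M k is Fresh then Known ((k == a) == f) else Done).
Proof.
apply/funext => k'; rewrite /phase_of /upd filter_rcons /=.
rewrite [k == k']eq_sym; case: eqVneq => [->|//].
by rewrite map_rcons /=; case: [seq e.2 | e <- M & e.1 == k] => [|e [|e' l]].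
Qed.

Lemma upd_id (s : J -> phase) k v : s k = v -> upd s k v = s.
Proof. by move=> <-; apply/funext => k'; rewrite /upd; case: eqP => [->|]. Qed.

Lemma mark_step_value (v : (J -> phase) -> R -> R) M A m other (b : R) :
  other != Some m ->
  let sel c := match [seq e.2 | e <- M & e.1 == m] with
               | [:: f] => if f then other else Some m
               | _ => if c then Some m else other
               end in
  2^-1 * v (phase_of (rcons M (m, sel true == Some m)))
     (A + (sel true == Some a)%:R * b) +
  2^-1 * v (phase_of (rcons M (m, sel false == Some m)))
     (A + (sel false == Some a)%:R * b) =
  effect_value v (Mark m (if (m == a) || (other == Some a) then b else 0))
    (phase_of M) A.
Proof.
move=> om sel; rewrite !phase_of_rcons /sel /=.
have Sma : (Some m == Some a) = (m == a) by [].
have := @upd_id (phase_of M) m Done.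
rewrite (_ : phase_of M m = match [seq e.2 | e <- M & e.1 == m] with
  | [::] => Fresh | [:: f] => Known ((m == a) == f) | _ => Done end) //.
case E : [seq e.2 | e <- M & e.1 == m] => [|f [|f' l]] updM.
- rewrite eqxx (negbTE om) Sma.
  case: (eqVneq m a) om => [->|ma] om; rewrite /= ?eqxx.
    by rewrite (negbTE om) mul1r mul0r addr0; field.
  by case: (other == Some a); rewrite /= ?mul1r ?mul0r ?addr0; field.
- clear updM; case: f E => E; rewrite ?Sma; case: (eqVneq m a) om => [->|ma] om; rewrite /= ?eqxx.
  + by rewrite (negbTE om) mul0r addr0; field.
  + by case: (other == Some a); rewrite /= ?mul1r ?mul0r ?addr0; field.
  + by rewrite mul1r; field.
  + by rewrite mul0r addr0; field.
- rewrite updM // Sma; case: (eqVneq m a) om => [->|ma] om; rewrite /= ?eqxx.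
    by rewrite (negbTE om) mul1r mul0r addr0; field.
  by case: (other == Some a); rewrite /= ?mul1r ?mul0r ?addr0; field.
Qed.

Lemma outcome_step_value (v : (J -> phase) -> R -> R) y M A :
  \sum_(c : bool) 2^-1 * v (phase_of (outcome_step (y, c) M).2)
     (A + outcome_gain (y, c) (outcome_step (y, c) M).1) =
  effect_value v (outcome_effect y) (phase_of M) A.
Proof.
rewrite big_bool /=; case: y => [[[i|] [j k]] p] /=; last first.
  by rewrite /outcome_gain /= !addr0; field.
rewrite /outcome_gain /=; have [jk|jk] := eqVneq j k.
  by case: (eqVneq j (Some a)) => _ /=; rewrite ?mul1r ?mul0r; field.
set d := if _ || _ then _ else _.
have coin : 2^-1 * v (phase_of M) (A + (j == Some a)%:R * rel_bid i) +
    2^-1 * v (phase_of M) (A + (k == Some a)%:R * rel_bid i) =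
    (v (phase_of M) (A + d) + v (phase_of M) A) / 2.
  rewrite /d; have [ja|_] := eqVneq j (Some a); rewrite /= ?mul1r ?mul0r ?addr0.
    have [ka|_] := eqVneq k (Some a); first by rewrite ja ka eqxx in jk.
    by rewrite mul0r addr0; field.
  by case: (k == Some a); rewrite /= ?mul1r ?mul0r ?addr0; field.
rewrite /two_way_socs; case: p.
  case: j @d jk coin => [m|] d jk coin //; case: ifP => _ //=.
  by rewrite mark_step_value // eq_sym.
case: k @d jk coin => [m|] d jk coin //; case: ifP => _ //=.
(* The marked agent is now [k], which coin [false] selects; hence the exchange of the two terms. *)
by rewrite addrC mark_step_value //= orbC.
Qed.

End Outcomes.

(** * Law of the outcomes *)

Lemma big_option (R : nmodType) (I : finType) (F : option I -> R) :
  \sum_o F o = F None + \sum_i F (Some i).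
Proof.
rewrite (bigD1 None) //=; congr (_ + _).
rewrite (reindex_omap (op := +%R) Some id) /=; last by case.
by apply: eq_bigl => i; rewrite eqxx.
Qed.

(** * Random variables with finitely many values *)

Section FiniteValued.
Local Open Scope classical_set_scope.
Local Open Scope ring_scope.
Context (R : realType) (d : measure_display) (Omega : measurableType d).
Context (P : probability Omega R).

Definition pr (E : set Omega) : R := fine (P E).

Lemma prK E : measurable E -> P E = (pr E)%:E.
Proof. by move=> mE; rewrite /pr fineK // fin_num_measure. Qed.

Lemma pr_ge0 E : 0 <= pr E.
Proof. by rewrite /pr fine_ge0. Qed.

Context (Y : finType) (X : Omega -> Y).
Hypothesis mX : forall y, measurable (X @^-1` [set y]).

Lemma expectation_finite (G : Y -> R) : (forall y, 0 <= G y) ->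
  ('E_P[fun w => G (X w)] = (\sum_y G y * pr (X @^-1` [set y]))%:E)%E.
Proof.
move=> G0; rewrite unlock.
transitivity (\int[P]_w (\sum_(y <- index_enum Y)
    (G y)%:E * (\1_(X @^-1` [set y]) w)%:E)%E)%E.
  apply: eq_integral => w _; rewrite (bigD1 (X w)) //= [X in (_ + X)%E]big1.
    by rewrite adde0 indicE mem_set // mule1.
  move=> y yX; rewrite indicE memNset ?mule0 // => /= /esym/eqP.
  by rewrite (negbTE yX).
have mi y : measurable_fun [set: Omega] (EFin \o (\1_(X @^-1` [set y]) : Omega -> R)).
  by apply/measurable_EFinP; exact: measurable_indic.
rewrite ge0_integral_sum //; last 2 first.
- by move=> y; exact: (measurable_funeM (G y)%:E (mi y)).
- by move=> y w _; rewrite -EFinM lee_fin mulr_ge0.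
rewrite -sumEFin; apply: eq_bigr => y _.
rewrite ge0_integralZl_EFin //; last exact: mi.
by rewrite integral_indic // setIT EFinM -prK.
Qed.

Lemma pr_finite (Q : pred Y) :
  pr [set w | Q (X w)] = \sum_(y | Q y) pr (X @^-1` [set y]).
Proof.
have mQ : measurable [set w | Q (X w)].
  rewrite (_ : [set w | _] = \bigcup_(y in [set y | Q y]) (X @^-1` [set y])).
    by apply: fin_bigcup_measurable => //; exact: finite_finset.
  by apply/seteqP; split => [w /= Qw|w [y /= Qy Xy]]; [exists (X w)|rewrite /= Xy].
apply: EFin_inj; rewrite -prK // -expectation_indic //.
have -> : \1_[set w | Q (X w)] = (fun w => (Q (X w))%:R) :> (Omega -> R).
  by apply/funext => w; rewrite indicE; congr (nat_of_bool _)%:R;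
     apply/idP/idP; rewrite inE.
rewrite (@expectation_finite (fun y => (Q y)%:R)) //; congr EFin.
rewrite [RHS]big_mkcond /=; apply: eq_bigr => y _.
by case: (Q y); rewrite ?mul1r ?mul0r.
Qed.

Lemma pr_finite_sum1 : \sum_y pr (X @^-1` [set y]) = 1.
Proof.
rewrite -(pr_finite predT) (_ : [set w | _] = setT).
  by rewrite /pr probability_setT.
by apply/seteqP; split.
Qed.

End FiniteValued.

(** * The intervals of the type decomposition *)

Section AgentAt.
Local Open Scope classical_set_scope.
Local Open Scope ring_scope.
Context (R : realType) (J : finType) (ord : seq J) (m : J -> R).
Hypothesis ordJ : perm_eq ord (enum J).
Hypothesis m0 : forall j, 0 <= m j.

Lemma mem_ord j : j \in ord.
Proof. by rewrite (perm_mem ordJ) mem_enum. Qed.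

Lemma sum_take_le (n n' : nat) : (n <= n')%N ->
  \sum_(k <- take n ord) m k <= \sum_(k <- take n' ord) m k.
Proof.
move=> nn'; rewrite -(subnKC nn') takeD big_cat /= lerDl.
by apply: sumr_ge0.
Qed.

Lemma interval_endE j :
  interval_start ord m j + m j = \sum_(k <- take (index j ord).+1 ord) m k.
Proof.
rewrite /interval_start (take_nth j) ?index_mem ?mem_ord // nth_index ?mem_ord //.
by rewrite big_rcons /= addrC.
Qed.

Lemma interval_start_ge0 j : 0 <= interval_start ord m j.
Proof. by apply: sumr_ge0. Qed.

Lemma interval_end_le j : interval_start ord m j + m j <= \sum_k m k.
Proof.
have -> : \sum_k m k = \sum_(k <- ord) m k by rewrite (perm_big _ ordJ) big_enum.
rewrite interval_endE -[X in _ <= \sum_(k <- X) _](cat_take_drop (index j ord).+1).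
by rewrite big_cat /= lerDl; apply: sumr_ge0.
Qed.

Lemma intervals_disjoint j k x :
  interval_start ord m j <= x < interval_start ord m j + m j ->
  interval_start ord m k <= x < interval_start ord m k + m k -> j = k.
Proof.
rewrite !interval_endE => /andP[j1 j2] /andP[k1 k2].
have [jk|kj|e] := ltngtP (index j ord) (index k ord).
- have h : _ <= interval_start ord m k := sum_take_le jk.
  by have := lt_le_trans j2 (le_trans h k1); rewrite ltxx.
- have h : _ <= interval_start ord m j := sum_take_le kj.
  by have := lt_le_trans k2 (le_trans h j1); rewrite ltxx.
by rewrite -(nth_index j (mem_ord j)) -(nth_index j (mem_ord k)) e.
Qed.

Lemma agent_at_Some j x : (agent_at ord m x == Some j) =
  (interval_start ord m j <= x < interval_start ord m j + m j).
Proof.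
rewrite /agent_at; case: pickP => [k kx|none]; last by rewrite none.
apply/eqP/idP => [[<-] //|jx]; by rewrite (intervals_disjoint jx kx).
Qed.

(** The shift [c] is meant to be [0] for [eta] and [2^-1] for its companion. *)
Lemma measurable_agent_at (c : R) (o : option J) :
  measurable [set e : R | agent_at ord m (e + c) = o].
Proof.
have mS j : measurable [set e : R | agent_at ord m (e + c) = Some j].
  rewrite (_ : [set e | _] = `[interval_start ord m j - c,
      interval_start ord m j + m j - c[%classic); first exact: measurable_itv.
  apply/seteqP; split => e /=; rewrite in_itv /=.
    by move/eqP; rewrite agent_at_Some; lra.
  by move=> h; apply/eqP; rewrite agent_at_Some; lra.
case: o => [j|] //.
rewrite (_ : [set e | _] = ~` \bigcup_(j in [set: J])
    [set e | agent_at ord m (e + c) = Some j]).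
  by apply: measurableC; apply: fin_bigcup_measurable.
apply/seteqP; split => e /=; first by move=> h [j _ /=]; rewrite h.
by move=> h; case E: (agent_at _ _ _) => [j|] //; exfalso; apply: h; exists j.
Qed.

End AgentAt.

(** * Independence and the joint law of the outcomes *)

Section Law.
Local Open Scope classical_set_scope.
Local Open Scope ring_scope.
Context (R : realType) (I J : finType) (T : nat) (W : adwords R I J T)
  (d : measure_display) (Omega : measurableType d) (P : probability Omega R)
  (arr : 'I_T -> Omega -> option I) (eta : 'I_T -> {RV P >-> R})
  (pick coin : 'I_T -> {RV P >-> bool})
  (rand : is_randomness W arr eta pick coin)
  (ord : seq J) (ordJ : perm_eq ord (enum J))
  (mu : 'I_T -> I -> J -> R) (mu_ge0 : forall t i j, 0 <= mu t i j).

Definition decomposition (t : 'I_T) (o : option I) (e : R) : option J * option J :=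
  if o is Some i then
    (agent_at ord (mu t i) e, agent_at ord (mu t i) (e + 2^-1))
  else (None, None).

Definition step_outcome (w : Omega) (t : 'I_T) : outcome I J * bool :=
  (arr t w, decomposition t (arr t w) (eta t w), pick t w, coin t w).

Lemma socs_stepE w M t :
  socs_step W ord mu arr eta pick coin w M t = outcome_step W (step_outcome w t) M.
Proof.
rewrite /socs_step /general_socs_step /step_outcome /outcome_step /decomposition.
by case: (arr t w).
Qed.

Lemma measurable_decomposition t o jk :
  measurable [set e | decomposition t o e = jk].
Proof.
case: o => [i|] /=.
  rewrite (_ : [set e | _] = [set e | agent_at ord (mu t i) (e + 0) = jk.1] `&`
     [set e | agent_at ord (mu t i) (e + 2^-1) = jk.2]).
    by apply: measurableI; apply: measurable_agent_at.
  apply/seteqP; split => e /=; rewrite addr0; first by move=> <-.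
  by case: jk => j k /= [-> ->].
have [<-|h] := eqVneq (None, None) jk.
  by rewrite (_ : [set e | _] = setT) //; apply/seteqP; split.
rewrite (_ : [set e | _] = set0) //; apply/seteqP; split => // e /= /eqP.
by rewrite (negbTE h).
Qed.

Lemma measurable_boolRV (X : {RV P >-> bool}) (B : set bool) : measurable (X @^-1` B).
Proof. by rewrite -[X in measurable X]setTI; apply: measurable_funP. Qed.

Lemma measurable_etaRV (X : {RV P >-> R}) (B : set R) :
  measurable B -> measurable (X @^-1` B).
Proof. by move=> mB; rewrite -[X in measurable X]setTI; apply: measurable_funP. Qed.

Lemma measurable_arr t (B : set (option I)) : measurable (arr t @^-1` B).
Proof.
rewrite (_ : _ @^-1` _ = \bigcup_(o in B) (arr t @^-1` [set o])).
  apply: fin_bigcup_measurable => [|o _]; first exact: finite_finset.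
  exact: (arr_measurable rand).
by apply/seteqP; split => [w Bw|w [y By ay]]; [exists (arr t w)|rewrite /= ay].
Qed.

(** Independence over the whole index set; full sets in some factors yield the marginal law of the
    others. *)
Lemma pr_steps (A : 'I_T -> set (option I)) (D : 'I_T -> set R)
    (Bp Bc : 'I_T -> set bool) : (forall t, measurable (D t)) ->
  pr P (\bigcap_(t in [set: 'I_T]) (arr t @^-1` A t `&` eta t @^-1` D t `&`
     pick t @^-1` Bp t `&` coin t @^-1` Bc t)) =
  \prod_t (pr P (arr t @^-1` A t) * pr P (eta t @^-1` D t) *
     pr P (pick t @^-1` Bp t) * pr P (coin t @^-1` Bc t)).
Proof.
move=> mD.
pose E (k : 'I_T + 'I_T + 'I_T + 'I_T) : set Omega := match k with
  | inl (inl (inl t)) => arr t @^-1` A t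
  | inl (inl (inr t)) => eta t @^-1` D t
  | inl (inr t) => pick t @^-1` Bp t
  | inr t => coin t @^-1` Bc t
  end.
have mE k : measurable (E k).
  case: k => [[[t|t]|t]|t] /=; [exact: measurable_arr|exact: measurable_etaRV
    |exact: measurable_boolRV|exact: measurable_boolRV].
have := steps_independent rand (A := [set: 'I_T + 'I_T + 'I_T + 'I_T]%SET) (E := E).
move=> ind.
have {}ind : P (\bigcap_(k in [set` [set: 'I_T + 'I_T + 'I_T + 'I_T]%SET]) E k)
   = (\prod_(k in [set: 'I_T + 'I_T + 'I_T + 'I_T]%SET) P (E k))%E.
  apply: ind => -[[[t|t]|t]|t] _ /=.
  - by exists (A t) => //; rewrite setTI.
  - by exists (D t) => //; rewrite setTI.
  - by exists (Bp t) => //; rewrite setTI.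
  - by exists (Bc t) => //; rewrite setTI.
have -> : \bigcap_(t in [set: 'I_T]) (arr t @^-1` A t `&` eta t @^-1` D t `&`
     pick t @^-1` Bp t `&` coin t @^-1` Bc t) =
   \bigcap_(k in [set` [set: 'I_T + 'I_T + 'I_T + 'I_T]%SET]) E k.
  apply/seteqP; split => w h.
    by move=> [[[t|t]|t]|t] _; have [[[]]] := h t Logic.I.
  move=> t _; split; [split; [split|]|].
  - by apply: (h (inl (inl (inl t)))); rewrite /= inE.
  - by apply: (h (inl (inl (inr t)))); rewrite /= inE.
  - by apply: (h (inl (inr t))); rewrite /= inE.
  - by apply: (h (inr t)); rewrite /= inE.
rewrite /pr ind (eq_bigr (fun k => (pr P (E k))%:E)); last by move=> k _; exact: prK.
rewrite prodEFin /= (eq_bigl predT); last by move=> k; rewrite inE.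
by rewrite !big_sumType /= -!big_split.
Qed.

Definition type_prob (t : 'I_T) (o : option I) : R := pr P (arr t @^-1` [set o]).

Definition decomposition_prob (t : 'I_T) (o : option I) (jk : option J * option J) : R :=
  pr P (eta t @^-1` [set e | decomposition t o e = jk]).

Definition outcome_prob (t : 'I_T) (y : outcome I J) : R :=
  let: (o, jk, p) := y in type_prob t o * decomposition_prob t o jk * 2^-1.

Lemma pr_boolRV (X : {RV P >-> bool}) (b : bool) :
  P (X @^-1` [set true]) = (2^-1)%:E -> pr P (X @^-1` [set b]) = 2^-1.
Proof.
move=> Xt; have t2 : pr P (X @^-1` [set true]) = 2^-1 by rewrite /pr Xt.
case: b => //; have := pr_finite_sum1 P (fun y => measurable_boolRV X [set y]).
by rewrite big_bool /= t2; move: (pr P _) => u h; lra.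
Qed.

Lemma pr_outcomes (x : {ffun 'I_T -> outcome I J * bool}) :
  measurable ((fun w => [ffun t => step_outcome w t]) @^-1` [set x]) /\
  pr P ((fun w => [ffun t => step_outcome w t]) @^-1` [set x]) =
  \prod_t (outcome_prob t (x t).1 * 2^-1).
Proof.
have -> : (fun w => [ffun t => step_outcome w t]) @^-1` [set x] =
  \bigcap_(t in [set: 'I_T]) (arr t @^-1` [set (x t).1.1.1] `&`
     eta t @^-1` [set e | decomposition t (x t).1.1.1 e = (x t).1.1.2] `&`
     pick t @^-1` [set (x t).1.2] `&` coin t @^-1` [set (x t).2]).
  apply/seteqP; split => w /=.
    by move=> <- t _; rewrite ffunE /step_outcome /=.
  move=> h; apply/ffunP => t; rewrite ffunE /step_outcome.
  have := h t Logic.I; case: (x t) => [[[ty jk] p] c] /= [[[-> ->] ->] ->] //.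
split.
  apply: fin_bigcap_measurable => [|t _]; first exact: finite_finset.
  apply: measurableI; last exact: measurable_boolRV.
  apply: measurableI; last exact: measurable_boolRV.
  apply: measurableI; first exact: measurable_arr.
  by apply: measurable_etaRV; exact: measurable_decomposition.
rewrite pr_steps; last by move=> t; exact: measurable_decomposition.
apply: eq_bigr => t _; rewrite (pr_boolRV _ (pick_law rand t)).
rewrite (pr_boolRV _ (coin_law rand t)) /outcome_prob.
by case: (x t) => [[[ty jk] p] c].
Qed.

Lemma pr_arrivals (x : {ffun 'I_T -> option I}) :
  measurable ((fun w => [ffun t => arr t w]) @^-1` [set x]) /\
  pr P ((fun w => [ffun t => arr t w]) @^-1` [set x]) = \prod_t type_prob t (x t).
Proof.
have -> : (fun w => [ffun t => arr t w]) @^-1` [set x] =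
  \bigcap_(t in [set: 'I_T]) (arr t @^-1` [set x t] `&`
     eta t @^-1` setT `&` pick t @^-1` setT `&` coin t @^-1` setT).
  apply/seteqP; split => w /=.
    by move=> <- t _; rewrite ffunE.
  by move=> h; apply/ffunP => t; rewrite ffunE; have [[[]]] := h t Logic.I.
split.
  apply: fin_bigcap_measurable => [|t _]; first exact: finite_finset.
  by rewrite !preimage_setT !setIT; exact: measurable_arr.
rewrite pr_steps //; apply: eq_bigr => t _.
by rewrite !preimage_setT /pr !probability_setT /= !mulr1.
Qed.

Lemma type_prob_Some t i : type_prob t (Some i) = arrival_prob W t i.
Proof. by rewrite /type_prob /pr (arr_law rand). Qed.

Lemma type_prob_sum1 t : \sum_o type_prob t o = 1.
Proof. by apply: pr_finite_sum1 => o; exact: measurable_arr. Qed.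

Lemma decomposition_prob_finite t o (Q : pred (option J * option J)) :
  \sum_(jk | Q jk) decomposition_prob t o jk =
  pr P (eta t @^-1` [set e | Q (decomposition t o e)]).
Proof.
rewrite (@pr_finite R d Omega P _ (fun w => decomposition t o (eta t w))) //.
move=> jk; exact: (measurable_etaRV (eta t) (measurable_decomposition t o jk)).
Qed.

Lemma outcome_prob_ge0 t y : 0 <= outcome_prob t y.
Proof.
by case: y => [[ty jk] p]; rewrite /outcome_prob !mulr_ge0 ?pr_ge0 // invr_ge0.
Qed.

Lemma sum_outcomes t (F : outcome I J -> R) :
  \sum_y outcome_prob t y * F y =
  \sum_o type_prob t o * \sum_jk decomposition_prob t o jk *
    ((F (o, jk, true) + F (o, jk, false)) / 2).
Proof.
transitivity (\sum_oj \sum_p outcome_prob t (oj, p) * F (oj, p)).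
  by rewrite pair_bigA; apply: eq_bigr => -[oj p].
transitivity (\sum_o \sum_jk \sum_p outcome_prob t (o, jk, p) * F (o, jk, p)).
  by rewrite [RHS]pair_bigA; apply: eq_bigr => -[? jk].
apply: eq_bigr => o _; rewrite mulr_sumr; apply: eq_bigr => jk _.
by rewrite big_bool /=; field.
Qed.

Lemma decomposition_prob_sum1 t o : \sum_jk decomposition_prob t o jk = 1.
Proof.
rewrite (decomposition_prob_finite t o predT) (_ : [set e | _] = setT).
  by rewrite preimage_setT /pr probability_setT.
by apply/seteqP; split.
Qed.

Lemma outcome_prob_sum1 t : \sum_y outcome_prob t y = 1.
Proof.
rewrite -(type_prob_sum1 t); under eq_bigr do rewrite -[outcome_prob _ _]mulr1.
rewrite (sum_outcomes t (fun=> 1)); apply: eq_bigr => o _.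
by rewrite -mulr_suml decomposition_prob_sum1; field.
Qed.

Lemma pr_eta_itv t (u v : R) :
  pr P (eta t @^-1` [set e | u <= e < v]) =
  2 * pos_part (Num.min v 2^-1 - Num.max u 0).
Proof.
rewrite (_ : [set e | _] = `[u, v[%classic); last first.
  by apply/seteqP; split => e /=; rewrite in_itv.
rewrite /pr (eta_law rand); last exact: measurable_itv.
rewrite (_ : `[u, v[%classic `&` `[0, 2^-1[%classic = `[Num.max u 0, Num.min v 2^-1[%classic); last first.
  apply/seteqP; split => e /=; rewrite !in_itv /= ge_max lt_min.
    by move=> [/andP[-> ->] /andP[-> ->]].
  by move=> /andP[/andP[-> ->] /andP[-> ->]].
rewrite lebesgue_measure_itv /= lte_fin /pos_part.
case: ltP => h; first by rewrite -EFinB -EFinM /= (@max_l _ _ (_ - _)) ?subr_ge0 ?ltW.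
by rewrite mule0 /= (@max_r _ _ (_ - _)) ?mulr0 ?subr_le0.
Qed.

Section OneType.
Variables (t : 'I_T) (i : I) (a : J).
Hypothesis mu_sum : \sum_j mu t i j <= 1.

Definition one_way_prob : R := decomposition_prob t (Some i) (Some a, Some a).

Definition two_way_prob : R :=
  \sum_(jk | (jk.1 != jk.2) && ((jk.1 == Some a) || (jk.2 == Some a)))
    decomposition_prob t (Some i) jk.

(** Both samples fall in the interval starting at [s] iff [eta] lies in its first [mu t i a - 2^-1]
    units, and [eta] has density 2. *)
Lemma one_way_probE : one_way_prob = pos_part (2 * mu t i a - 1).
Proof.
pose s := interval_start ord (mu t i) a.
have s0 : 0 <= s by exact: interval_start_ge0.
have s1 : s + mu t i a <= 1.
  by apply: le_trans mu_sum; exact: interval_end_le.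
rewrite /one_way_prob /decomposition_prob.
rewrite (_ : [set e | _] = [set e | s <= e < s + mu t i a - 2^-1]); last first.
  have mi := mu_ge0 t i; apply/seteqP; split => e /=.
    move=> [/eqP + /eqP]; rewrite !agent_at_Some // -/s; lra.
  move=> h; congr (_, _); apply/eqP; rewrite agent_at_Some // -/s;
    have := mi a; lra.
rewrite pr_eta_itv min_l; last lra.
rewrite max_l // /pos_part; have [h|h] := leP (mu t i a) (2^-1).
  by rewrite !max_r; lra.
by rewrite !max_l; lra.
Qed.

(** Double counting: the left side adds the probabilities that [eta] and [eta + 2^-1] hit the
    interval of [a]. Together the two samples sweep [[0, 1)] with density 2. *)
Lemma one_two_way_prob : 2 * one_way_prob + two_way_prob = 2 * mu t i a.
Proof.
pose s := interval_start ord (mu t i) a.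
have s0 : 0 <= s by exact: interval_start_ge0.
have s1 : s + mu t i a <= 1.
  by apply: le_trans mu_sum; exact: interval_end_le.
have ma := mu_ge0 t i a.
transitivity (\sum_(jk | jk.1 == Some a) decomposition_prob t (Some i) jk +
   \sum_(jk | jk.2 == Some a) decomposition_prob t (Some i) jk).
  rewrite (big_mkcond (fun jk : option J * option J => jk.1 == Some a)).
  rewrite (big_mkcond (fun jk : option J * option J => jk.2 == Some a)) -big_split /=.
  rewrite (bigD1 (Some a, Some a)) //= eqxx.
  rewrite /one_way_prob mulr2n mulrDl mul1r; congr (_ + _).
  rewrite /two_way_prob big_mkcond [RHS]big_mkcond /=.
  apply: eq_bigr => -[j k] _ /=; rewrite xpair_eqE.
  have [->|ja] := eqVneq j (Some a); have [->|ka] := eqVneq k (Some a).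
  - by [].
  - by rewrite addr0.
  - by rewrite /= ja add0r.
  - by rewrite /= andbF addr0.
rewrite !decomposition_prob_finite /=.
rewrite (_ : [set e | _] = [set e | s <= e < s + mu t i a]); last first.
  by apply/seteqP; split => e /=; rewrite agent_at_Some.
rewrite [X in _ + pr _ (_ @^-1` X)](_ : _ =
    [set e | s - 2^-1 <= e < s + mu t i a - 2^-1]); last first.
  by apply/seteqP; split => e /=; rewrite agent_at_Some // -/s; lra.
rewrite !pr_eta_itv (@max_l _ _ s) // (@min_l _ _ (s + mu t i a - 2^-1)); last lra.
rewrite /pos_part; have [h|h] := leP s (2^-1).
  rewrite (@max_r _ _ (s - 2^-1)); last lra.
  have [h'|h'] := leP (s + mu t i a) (2^-1).
    by rewrite max_l ?max_r; lra.
  by rewrite !max_l; lra.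
rewrite (@max_l _ _ (s - 2^-1)); last lra.
have h' : 2^-1 <= s + mu t i a by lra.
by rewrite min_r // max_r ?max_l; lra.
Qed.

End OneType.

End Law.

(** * Expected bids, marks and the linear program *)

Section Run.
Local Open Scope classical_set_scope.
Local Open Scope ring_scope.
Context (R : realType) (I J : finType) (T : nat) (W : adwords R I J T) (a : J).

Definition run_step (x : outcome I J * bool) (st : marks J * R) : marks J * R :=
  ((outcome_step W x st.1).2,
   st.2 + outcome_gain W a x (outcome_step W x st.1).1).

Lemma path_value_value (q : 'I_T -> outcome I J -> R) l M A :
  path_value (fun t x => q t x.1 * 2^-1) run_step (fun st => pos_part (1 - st.2))
    l (M, A) = value q (outcome_effect W a) l (phase_of a M) A.
Proof.
elim: l M A => [//|t l IH] M A /=.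
transitivity (\sum_y \sum_c q t y * 2^-1 * path_value (fun t x => q t x.1 * 2^-1)
    run_step (fun st => pos_part (1 - st.2)) l (run_step (y, c) (M, A))).
  by rewrite pair_bigA; apply: eq_bigr => -[y c].
apply: eq_bigr => y _; rewrite -outcome_step_value mulr_sumr.
by apply: eq_bigr => c _; rewrite IH mulrA.
Qed.

Lemma rel_bid_ge0 i : 0 <= rel_bid W a i.
Proof. by apply: divr_ge0; [exact: bid_ge0|apply/ltW/budget_gt0]. Qed.

Lemma rel_bid_le1 i : rel_bid W a i <= 1.
Proof. by rewrite ler_pdivrMr ?budget_gt0 // mul1r bid_le_budget. Qed.

Lemma rel_bid_large i :
  (2 / 3 * budget W a <= bid W i a) = (2 / 3 <= rel_bid W a i).
Proof. by rewrite ler_pdivlMr ?budget_gt0. Qed.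

Lemma outcome_amount_ge0 y : 0 <= amount (outcome_effect W a y).
Proof.
have b0 := rel_bid_ge0; case: y => [[[i|] [j k]] p] //=.
case: ifP => _ /=; first by case: ifP.
case: (if p then j else k) => [m|] /=; last by case: ifP.
by case: ifP => _ /=; case: ifP.
Qed.

Lemma outcome_amount_le1 y : amount (outcome_effect W a y) <= 1.
Proof.
have b1 := rel_bid_le1; case: y => [[[i|] [j k]] p] //=.
case: ifP => _ /=; first by case: ifP.
case: (if p then j else k) => [m|] /=; last by case: ifP.
by case: ifP => _ /=; case: ifP.
Qed.

Lemma outcome_amount_marked y : marks_agent a (outcome_effect W a y) ->
  2 / 3 <= amount (outcome_effect W a y).
Proof.
case: y => [[[i|] [j k]] p] //=; case: ifP => _ //=.
case E: (if p then j else k) => [m|] //=; case: ifP => //= large /eqP ma.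
rewrite ma rel_bid_large in large E.
by case: p E => ->; rewrite eqxx ?orbT.
Qed.

(** The function [h] is abstract in order to serve both [loss] and [hinge_loss]. *)
Lemma outcome_sure_prob (h : R -> R) i (jk : option J * option J) p : h 0 = 0 ->
  sure_prob (outcome_effect W a (Some i, jk, p)) *
    h (amount (outcome_effect W a (Some i, jk, p))) =
  h (rel_bid W a i) * ((jk == (Some a, Some a))%:R +
    2^-1 * ((jk.1 != jk.2) && ((jk.1 == Some a) || (jk.2 == Some a)))%:R).
Proof.
move=> h0; case: jk => j k; rewrite xpair_eqE /=.
have [<-|jk] := eqVneq j k.
  by case: (j == Some a) => /=; rewrite ?h0; ring.
have -> : (j == Some a) && (k == Some a) = false.
  by apply/negP => /andP[/eqP ja /eqP ka]; rewrite ja ka eqxx in jk.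
case: (if p then j else k) => [m|]; last first.
  by case: (_ || _); rewrite /= ?h0; ring.
by case: ifP => _ /=; case: (_ || _); rewrite /= ?h0; ring.
Qed.

(** In a two-way type involving [a], exactly one value of [pick] proposes [a] for the mark. *)
Lemma outcome_marks_agent i (jk : option J * option J) :
  (marks_agent a (outcome_effect W a (Some i, jk, true)))%:R *
    (1 - amount (outcome_effect W a (Some i, jk, true)) / 2) +
  (marks_agent a (outcome_effect W a (Some i, jk, false)))%:R *
    (1 - amount (outcome_effect W a (Some i, jk, false)) / 2) =
  (2 / 3 <= rel_bid W a i)%R%:R * (1 - rel_bid W a i / 2) *
    ((jk.1 != jk.2) && ((jk.1 == Some a) || (jk.2 == Some a)))%:R.
Proof.
case: jk => j k /=; have [_|jk] := eqVneq j k; first by rewrite /=; ring.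
rewrite -rel_bid_large.
have nM o (d : R) : o != Some a -> marks_agent a
   (if o is Some m then
      if 2 / 3 * budget W m <= bid W i m then Mark m d else Coin J d
    else Coin J d) = false.
  by case: o => [m|] //= ma; case: ifP => _ //=; apply/negbTE.
have yM (d : R) : marks_agent a
   (if 2 / 3 * budget W a <= bid W i a then Mark a d else Coin J d) =
   (2 / 3 * budget W a <= bid W i a).
  by case: ifP => //= _; rewrite eqxx.
have [ja|ja] := eqVneq j (Some a).
  have ka : k != Some a by rewrite eq_sym -ja.
  rewrite (nM _ _ ka) ja yM; case: ifP => _ /=; ring.
rewrite (nM _ _ ja); have [ka|ka] := eqVneq k (Some a).
  by rewrite ka yM; case: ifP => _ /=; ring.
by rewrite (nM _ _ ka) /=; ring.
Qed.

End Run.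

(** * From the algorithm to the value of the selection process *)

Section Analysis.
Local Open Scope classical_set_scope.
Local Open Scope ring_scope.
Context (R : realType) (I J : finType) (T : nat) (W : adwords R I J T)
  (d : measure_display) (Omega : measurableType d) (P : probability Omega R)
  (arr : 'I_T -> Omega -> option I) (eta : 'I_T -> {RV P >-> R})
  (pick coin : 'I_T -> {RV P >-> bool})
  (rand : is_randomness W arr eta pick coin)
  (ord : seq J) (ordJ : perm_eq ord (enum J))
  (mu : 'I_T -> I -> J -> R) (mu_ge0 : forall t i j, 0 <= mu t i j)
  (a : J).

Let q := outcome_prob arr eta ord mu.
Let eff := outcome_effect W a.
Let f := arrival_prob W.
Let b := rel_bid W a.

(** The fold carries marks and bid together, whereas [allocated] recomputes the marks for each step;
    they agree on every prefix. *)
Lemma allocated_bidE w :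
  (foldl (fun st t => run_step W a (step_outcome arr eta pick coin ord mu w t) st)
     ([::], 0) (enum 'I_T)).2 =
  allocated_bid W ord mu arr eta pick coin a w / budget W a.
Proof.
pose X := step_outcome arr eta pick coin ord mu w.
pose al := allocated W ord mu arr eta pick coin w.
have loop n : (n <= T)%N ->
    foldl (fun st t => run_step W a (X t) st) ([::], 0) (take n (enum 'I_T)) =
    (foldl (fun M s => (socs_step W ord mu arr eta pick coin w M s).2) [::]
       (take n (enum 'I_T)),
     \sum_(t < T | (t < n)%N) outcome_gain W a (X t) (al t)).
  elim: n => [|n IH] nT; first by rewrite take0 /= big_pred0.
  pose t := Ordinal nT.
  have tE : nth t (enum 'I_T) n = t.
    by apply: val_inj; rewrite /= nth_enum_ord.
  rewrite (take_nth t) ?size_enum_ord // tE !foldl_rcons IH ?(ltnW nT) //.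
  rewrite /run_step /X -!socs_stepE /=; congr (_, _).
  rewrite [RHS](bigD1 t) //= addrC; congr (_ + _).
  apply: eq_bigl => s; rewrite ltnS -val_eqE /= [RHS]andbC ltn_neqAle.
  by [].
have := loop T (leqnn T); rewrite take_oversize ?size_enum_ord // => -> /=.
rewrite (eq_bigl predT) => [|t]; last by rewrite ltn_ord.
rewrite /allocated_bid mulr_suml; apply: eq_bigr => t _.
rewrite mulr_suml /outcome_gain /X /step_outcome /=.
case: (arr t w) => [i|]; last by rewrite big1 // => i _; rewrite !mul0r.
rewrite (bigD1 i) //= eqxx /= big1 ?addr0 => [|i' i'i].
  by rewrite /rel_bid mulrA.
by rewrite (_ : (Some i == Some i') = (i == i')) // eq_sym (negbTE i'i) !mul0r.
Qed.

Lemma expected_shortfallE :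
  ('E_P[fun w => pos_part
      (1 - allocated_bid W ord mu arr eta pick coin a w / budget W a)%R] =
   (value q eff (enum 'I_T) (fun=> Fresh) 0)%:E)%E.
Proof.
pose X := fun w => [ffun t => step_outcome arr eta pick coin ord mu w t].
pose G := fun x : {ffun 'I_T -> outcome I J * bool} =>
  pos_part (1 - (foldl (fun st t => run_step W a (x t) st)
     ([::], 0) (enum 'I_T)).2).
have -> : (fun w => pos_part
      (1 - allocated_bid W ord mu arr eta pick coin a w / budget W a)%R) =
    (fun w => G (X w)).
  apply/funext => w; rewrite /G -allocated_bidE /X; congr (pos_part (1 - _.2)).
  by elim: (enum 'I_T) ([::], 0) => //= t l IH st; rewrite ffunE IH.
rewrite expectation_finite; last 2 first.
- by move=> x; have [] := pr_outcomes rand ordJ mu_ge0 x.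
- by move=> x; exact: pos_part_ge0.
congr EFin; rewrite -[fun=> Fresh]/(phase_of a [::]) -path_value_value -sum_paths.
apply: eq_bigr => x _; rewrite mulrC.
by have [_ ->] := pr_outcomes rand ordJ mu_ge0 x.
Qed.

Hypothesis feasible : lp_feasible W P arr (fun t i j => f t i * mu t i j).

Lemma mu_sum_le1 t i : 0 < f t i -> \sum_j mu t i j <= 1.
Proof.
move=> f0; have := lp_arrival feasible t i.
by rewrite -mulr_sumr -[leRHS]mulr1 ler_pM2l.
Qed.

Let owp t i := one_way_prob eta ord mu t i a.
Let twp t i := two_way_prob eta ord mu t i a.

(** The decomposition followed by a fair selection preserves the share of [a]. The factor [f t i]
    covers types that never arrive, whose total [mu] feasibility does not bound. *)
Lemma arrival_way t i :
  f t i * (owp t i + 2^-1 * twp t i) = f t i * mu t i a.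
Proof.
have := arrival_prob_ge0 W t i; rewrite le_eqVlt => /orP[/eqP h|f0].
  by rewrite /f -h !mul0r.
have := one_two_way_prob rand ordJ mu_ge0 a (mu_sum_le1 f0).
by rewrite -/(owp t i) -/(twp t i) => h; congr (_ * _); lra.
Qed.

Lemma arrival_two_way t i :
  f t i * (2^-1 * twp t i) = f t i * Num.min (mu t i a) (1 - mu t i a).
Proof.
have := arrival_prob_ge0 W t i; rewrite le_eqVlt => /orP[/eqP h|f0].
  by rewrite /f -h !mul0r.
have := one_two_way_prob rand ordJ mu_ge0 a (mu_sum_le1 f0).
rewrite (one_way_probE rand ordJ mu_ge0 a (mu_sum_le1 f0)) -/(twp t i) /pos_part.
have [h|h] := leP (mu t i a) (2^-1).
  by rewrite max_r ?min_l; [|lra..] => e; congr (_ * _); lra.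
by rewrite max_l ?min_r; [|lra..] => e; congr (_ * _); lra.
Qed.

Lemma sum_sure_prob (h : R -> R) t : h 0 = 0 ->
  \sum_y q t y * (sure_prob (eff y) * h (amount (eff y))) =
  \sum_i f t i * mu t i a * h (b i).
Proof.
move=> h0.
rewrite (sum_outcomes _ _ _ _ _ (fun y => sure_prob (eff y) * h (amount (eff y)))).
rewrite big_option [X in _ * X]big1 => [|[j k] _]; last first.
  by rewrite /eff /= h0 !mulr0 addr0 mul0r mulr0.
rewrite mulr0 add0r; apply: eq_bigr => i _.
rewrite (type_prob_Some rand) -arrival_way -!mulrA; congr (_ * _).
have -> : owp t i + 2^-1 * twp t i = \sum_(jk : option J * option J)
    decomposition_prob eta ord mu t (Some i) jk * ((jk == (Some a, Some a))%:R +
    2^-1 * ((jk.1 != jk.2) && ((jk.1 == Some a) || (jk.2 == Some a)))%:R).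
  under [RHS]eq_bigr do rewrite mulrDr.
  rewrite big_split /=; congr (_ + _).
    rewrite (bigD1 (Some a, Some a)) //= eqxx mulr1 big1 ?addr0 // => jk.
    by move=> /negbTE ->; rewrite mulr0.
  rewrite /twp /two_way_prob big_mkcond mulr_sumr; apply: eq_bigr => jk _.
  by case: (_ && _); rewrite /=; ring.
rewrite mulr_suml; apply: eq_bigr => jk _.
by rewrite /eff !(outcome_sure_prob W a i jk _ h0) -/b; field.
Qed.

Lemma lossE t : loss q eff t = \sum_i f t i * mu t i a * b i.
Proof. exact: (@sum_sure_prob id). Qed.

Lemma hinge_lossE t : hinge_loss q eff t =
  \sum_i f t i * mu t i a * Num.min (b i) (1 - b i).
Proof.
apply: (@sum_sure_prob (fun x => Num.min x (1 - x))).
by rewrite subr0 min_l.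
Qed.

Lemma mark_lossE t : mark_loss q eff a t =
  \sum_(i | 2 / 3 <= b i)
    f t i * Num.min (mu t i a) (1 - mu t i a) * (1 - b i / 2).
Proof.
rewrite /mark_loss big_mkcond /=.
rewrite (eq_bigr (fun y => q t y * ((marks_agent a (eff y))%:R *
   (1 - amount (eff y) / 2)))); last first.
  by move=> y _; case: ifP => _; rewrite ?mul1r ?mul0r ?mulr0.
rewrite (sum_outcomes _ _ _ _ _ (fun y => (marks_agent a (eff y))%:R *
   (1 - amount (eff y) / 2))).
rewrite big_option [X in _ * X]big1 => [|[j k] _]; last first.
  by rewrite /eff /= !mul0r addr0 mul0r mulr0.
rewrite mulr0 add0r [RHS]big_mkcond /=; apply: eq_bigr => i _.
rewrite (type_prob_Some rand) -arrival_two_way.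
under eq_bigr => jk _ do rewrite outcome_marks_agent.
rewrite -/b /twp /two_way_prob.
case: (2 / 3 <= b i) => /=; last first.
  by rewrite big1 ?mulr0 // => jk _; rewrite !mul0r mulr0.
rewrite -[RHS]mulrA; congr (_ * _).
rewrite [in RHS]big_mkcond /= mulr_sumr mulr_suml.
by apply: eq_bigr => jk _; case: (_ && _); rewrite /=; field.
Qed.

(** * Consequences of the linear program constraints *)

Let hit (S : {set 'I_T * I}) t : R := \sum_(i | (t, i) \in S) f t i.

(** The capped bid vanishes unless some pair of [S] arrives, and is otherwise at most the budget;
    the steps are independent. *)
Lemma vbar_le (S : {set 'I_T * I}) :
  (vbar W P arr a S <= (budget W a * (1 - \prod_t (1 - hit S t)))%:E)%E.
Proof.
pose X := fun w => [ffun t => arr t w].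
pose miss t (o : option I) : R := if o is Some i then ((t, i) \notin S)%:R else 1.
pose G := fun x : {ffun 'I_T -> option I} => Num.min
  (\sum_(s in S) (x s.1 == Some s.2)%:R * bid W s.2 a) (budget W a).
have B0 := budget_gt0 W a.
have G0 x : 0 <= G x.
  rewrite le_min (ltW B0) andbT; apply: sumr_ge0 => s _.
  by rewrite mulr_ge0 // bid_ge0.
have -> : vbar W P arr a S = (\sum_x G x * \prod_t type_prob P arr t (x t))%:E.
  rewrite /vbar (_ : capped_bid W arr a S = (fun w => G (X w))); last first.
    apply/funext => w; rewrite /capped_bid /G; congr (Num.min _ _).
    by apply: eq_bigr => s _; rewrite ffunE.
  rewrite expectation_finite //; last first.
    by move=> x; have [] := pr_arrivals rand x.
  congr EFin; apply: eq_bigr => x _; congr (_ * _).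
  by have [_ ->] := pr_arrivals rand x.
have GB x : G x <= budget W a * (1 - \prod_t miss t (x t)).
  have [/forallP all_miss|/forallPn[t]] := boolP [forall t, miss t (x t) == 1].
    rewrite big1 ?subrr ?mulr0; last by move=> t _; exact/eqP/all_miss.
    rewrite /G big1 ?ge_min ?lexx // => -[t i] /= tiS.
    case: eqP => [xt|]; last by rewrite mul0r.
    by have := all_miss t; rewrite /miss xt tiS /= eq_sym oner_eq0.
  move=> tm; rewrite (bigD1 t) //= (_ : miss t (x t) = 0); last first.
    by move: tm; rewrite /miss; case: (x t) => [i|]; rewrite ?eqxx //; case: (_ \notin _); rewrite ?eqxx.
  by rewrite mul0r subr0 mulr1 ge_min lexx orbT.
have p0 x : 0 <= \prod_t type_prob P arr t (x t).
  by apply: prodr_ge0 => t _; exact: pr_ge0.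
rewrite lee_fin.
apply: (@le_trans _ _ (\sum_(x : {ffun 'I_T -> option I})
    budget W a * (1 - \prod_t miss t (x t)) * \prod_t type_prob P arr t (x t))).
  by apply: ler_sum => x _; apply: ler_wpM2r; [exact: p0|exact: GB].
rewrite (eq_bigr (fun x : {ffun 'I_T -> option I} => budget W a *
   (\prod_t type_prob P arr t (x t) -
    \prod_t (miss t (x t) * type_prob P arr t (x t))))); last first.
  by move=> x _; rewrite big_split /=; ring.
rewrite -mulr_sumr sumrB -(bigA_distr_bigA (fun t o => type_prob P arr t o)).
rewrite -(bigA_distr_bigA (fun t o => miss t o * type_prob P arr t o)) /=.
rewrite big1 => [|t _]; last exact: (type_prob_sum1 rand).
rewrite (eq_bigr (fun t => 1 - hit S t)) // => t _.
rewrite -(type_prob_sum1 rand t) !big_option mul1r -addrA; congr (_ + _).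
rewrite /hit (big_mkcond (fun i => (t, i) \in S)) /= -sumrB; apply: eq_bigr => i _.
by rewrite (type_prob_Some rand); case: ifP => _; rewrite /= ?mul0r ?mul1r ?subrr ?subr0.
Qed.

Lemma lp_coverage (S : {set 'I_T * I}) :
  \sum_t \sum_(i | (t, i) \in S) f t i * mu t i a * b i <=
  1 - \prod_t (1 - hit S t).
Proof.
have B0 := budget_gt0 W a.
have := le_trans (lp_budget feasible a S) (vbar_le S).
rewrite lee_fin -ler_pdivrMl // => h; apply: le_trans h.
rewrite pair_big_dep /= mulr_sumr; rewrite le_eqVlt; apply/orP; left; apply/eqP.
rewrite (eq_bigl (fun s => s \in S)) => [|[t i] //].
by apply: eq_bigr => -[t i] _ /=; rewrite /b /rel_bid; field; rewrite gt_eqF.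
Qed.

Lemma hit_ge0 S t : 0 <= hit S t.
Proof. by apply: sumr_ge0 => i _; exact: arrival_prob_ge0. Qed.

Lemma hit_le1 S t : hit S t <= 1.
Proof.
apply: le_trans (arrival_prob_le1 W t); rewrite /hit big_mkcond /=.
by apply: ler_sum => i _; case: ifP => // _; exact: arrival_prob_ge0.
Qed.

Lemma fractional_loadE : fractional_load W mu a = \sum_t loss q eff t.
Proof.
by apply: eq_bigr => t _; rewrite lossE; apply: eq_bigr => i _; rewrite /b /rel_bid mulrA.
Qed.

Lemma loss_ge0 t : 0 <= loss q eff t.
Proof.
rewrite lossE; apply: sumr_ge0 => i _; apply: mulr_ge0; last exact: rel_bid_ge0.
by apply: mulr_ge0; [exact: arrival_prob_ge0|exact: mu_ge0].
Qed.

Lemma fractional_load_le1 : \sum_t loss q eff t <= 1.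
Proof.
have p0 : 0 <= \prod_t (1 - hit [set: 'I_T * I]%SET t).
  by apply: prodr_ge0 => t _; rewrite subr_ge0 hit_le1.
rewrite (eq_bigr (fun t => \sum_(i | (t, i) \in [set: 'I_T * I]%SET)
    f t i * mu t i a * b i)) => [|t _]; last first.
  by rewrite lossE; apply: eq_bigl => i; rewrite inE.
by apply: le_trans (lp_coverage _) _; rewrite gerBl.
Qed.

Let heavy : {set 'I_T * I} :=
  [set s | (2 / 3 <= b s.2) && (1 < 2 * mu s.1 s.2 a)]%SET.

(** On a heavy pair the product of [mu] and the relative bid exceeds [1 / 3]. *)
Lemma hit_heavy_le t : hit heavy t <= 3 * loss q eff t.
Proof.
rewrite /hit lossE mulr_sumr big_mkcond /=; apply: ler_sum => i _.
have f0 := arrival_prob_ge0 W t i; have m0 := mu_ge0 t i a.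
have b0 := rel_bid_ge0 W a i; rewrite -/(f t i) -/(b i) in f0 b0 *.
rewrite inE /=; case: ifP => [/andP[b23 m12]|_].
  suff : 0 <= f t i * (3 * (mu t i a * b i) - 1) by lra.
  by apply: mulr_ge0 => //; nra.
by apply: mulr_ge0 => //; apply: mulr_ge0 => //; apply: mulr_ge0.
Qed.

(** Once twice the constraint on [heavy] is added, the inequality holds separately for every pair of
    a step and a type. *)
Lemma loss_le_gains :
  \sum_t loss q eff t <= 2 * (\sum_t mark_loss q eff a t) +
    2 * (\sum_t hinge_loss q eff t) +
    (2 * (1 - \prod_t (1 - hit heavy t)) - \sum_t hit heavy t).
Proof.
have := lp_coverage heavy.
suff : \sum_t loss q eff t <= 2 * (\sum_t mark_loss q eff a t) +
    2 * (\sum_t hinge_loss q eff t) +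
   (2 * (\sum_t \sum_(i | (t, i) \in heavy) f t i * mu t i a * b i) -
     \sum_t hit heavy t) by lra.
rewrite !mulr_sumr -sumrB -!big_split /=; apply: ler_sum => t _.
rewrite lossE mark_lossE hinge_lossE /hit.
rewrite (big_mkcond (fun i => 2 / 3 <= b i)).
rewrite !(big_mkcond (fun i => (t, i) \in heavy)) /=.
rewrite !mulr_sumr -sumrB -!big_split /=; apply: ler_sum => i _.
have f0 := arrival_prob_ge0 W t i; have m0 := mu_ge0 t i a.
have b0 := rel_bid_ge0 W a i; have b1 := rel_bid_le1 W a i.
rewrite -/(f t i) -/(b i) in f0 b0 b1 *.
rewrite inE /=; move: (f t i) (mu t i a) (b i) f0 m0 b0 b1 => F m B F0 m0 B0 B1.
have [Bl|Bl] := leP (2 / 3) B; rewrite /=; last first.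
  (* For [B] in [[0, 1]], [2 * Num.min B (1 - B)] reaches [B] exactly when [B <= 2 / 3]. *)
  suff : 0 <= F * m * (2 * Num.min B (1 - B) - B) by lra.
  apply: mulr_ge0; first exact: mulr_ge0.
  have [h|h] := leP B (2^-1); first by rewrite min_l; lra.
  by rewrite min_r; lra.
rewrite (@min_r _ _ B); last lra.
have [m12|m12] := ltP 1 (2 * m).
  rewrite min_r; last lra.
  (* The terms in [m] cancel and the bracket equals [1 - B]. *)
  suff : 0 <= F * (2 * (1 - m) * (1 - B / 2) + 2 * m * (1 - B) +
      (2 * (m * B) - 1) - m * B) by lra.
  by apply: mulr_ge0 => //; nra.
rewrite min_l; last lra.
suff : 0 <= F * m * (2 * (1 - B / 2) + 2 * (1 - B) - B) by lra.
by apply: mulr_ge0; [exact: mulr_ge0|lra].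
Qed.

Lemma mark_loss_le_loss t : mark_loss q eff a t <= loss q eff t.
Proof.
rewrite lossE mark_lossE big_mkcond /=; apply: ler_sum => i _.
have f0 := arrival_prob_ge0 W t i; have m0 := mu_ge0 t i a.
have b0 := rel_bid_ge0 W a i; rewrite -/(f t i) -/(b i) in f0 b0 *.
case: ifP => Bl; last by apply: mulr_ge0 => //; exact: mulr_ge0.
rewrite -![f t i * _ * _]mulrA; apply: ler_wpM2l => //.
have h : Num.min (mu t i a) (1 - mu t i a) <= mu t i a by rewrite ge_min lexx.
have b1 : b i <= 1 by exact: rel_bid_le1.
apply: (@le_trans _ _ (mu t i a * (1 - b i / 2))).
  by apply: ler_wpM2r => //; lra.
by apply: ler_wpM2l => //; lra.
Qed.

Lemma value_le_socs_bound :
  value q eff (enum 'I_T) (fun=> Fresh) 0 <= socs_bound (fractional_load W mu a).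
Proof.
have q0 : forall t y, 0 <= q t y by exact: outcome_prob_ge0.
have q1 : forall t, \sum_y q t y = 1 by exact: (outcome_prob_sum1 rand ordJ mu_ge0).
have a0 : forall y, 0 <= amount (eff y) by exact: outcome_amount_ge0.
have a1 : forall y, amount (eff y) <= 1 by exact: outcome_amount_le1.
have am : forall y, marks_agent a (eff y) -> 2 / 3 <= amount (eff y).
  by exact: outcome_amount_marked.
have n0 := hinge_loss_ge0 q0 a0 a1.
have m0 := @mark_loss_ge0 _ _ _ _ q eff q0 a1 a.
have cn := loss_hinge_le1 q0 q1 a0 a1.
have cm := @loss_mark_le1 _ _ _ _ q eff q0 q1 a0 a1 a.
have ny t : 0 <= hinge_loss q eff t <= loss q eff t.
  by rewrite n0 (hinge_loss_le_loss _ q0).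
have my t : 0 <= mark_loss q eff a t <= loss q eff t.
  by rewrite m0 mark_loss_le_loss.
have y01 t : 0 <= loss q eff t <= 1.
  by have := loss_ge0 t; have := cn t; have := n0 t; lra.
have sumE (F : 'I_T -> R) : \sum_(t <- enum 'I_T) F t = \sum_t F t.
  by rewrite big_enum.
have [_ pn] := at_most_one_poisson (enum 'I_T) ny cn.
have [_ pm] := at_most_one_poisson (enum 'I_T) my cm.
have po := prod_onem_le (enum 'I_T) y01.
rewrite !sumE big_split /= opprD expRD in pn.
rewrite !sumE big_split /= opprD expRD in pm.
rewrite !sumE -mulr_suml in po.
rewrite fractional_loadE.
apply: (@le_socs_bound _ _ _ (\sum_t loss q eff t ^+ 2)
  (\sum_t hinge_loss q eff t) (\sum_t mark_loss q eff a t)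
  (survival q eff (enum 'I_T))
  (at_most_one (loss q eff) (mark_loss q eff a) (enum 'I_T)).2
  (at_most_one (loss q eff) (hinge_loss q eff) (enum 'I_T)).2).
- by rewrite fractional_load_le1 andbT; apply: sumr_ge0 => t _; exact: loss_ge0.
- by apply: sumr_ge0 => t _; exact: sqr_ge0.
- exact: sumr_ge0.
- exact: sumr_ge0.
- have := @value_fresh _ _ _ _ q eff q0 q1 a0 a1 a am (enum 'I_T) (fun=> Fresh) 0
    (lexx _) (fun _ _ => isT).
  by rewrite upd_id // subr0 {1}/pos_part max_l // [leRHS]mul1r.
- have := @value_hinge _ _ _ _ q eff q0 q1 a0 a1 (enum 'I_T) (fun=> Fresh) 0
    (lexx _) (fun=> isT).
  by rewrite /hinge mulr0 subr0 /pos_part max_l // min_l // mul1r mul0r addr0.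
- exact: at_most_one_le_prod.
- exact: po.
- by rewrite (mulrC (1 + _)) mulrA.
- by rewrite (mulrC (1 + _)) mulrA.
move=> sg.
(* A spread of at most [1 / 81] keeps each loss below [1 / 9], hence each hit within the range
   [[0, 1 / 3]] of [coverage_excess_le]. *)
have small t : loss q eff t <= 1 / 9.
  have : loss q eff t ^+ 2 <= \sum_t loss q eff t ^+ 2.
    by rewrite (bigD1 t) //= lerDl; apply: sumr_ge0 => s _; exact: sqr_ge0.
  by have := loss_ge0 t; nra.
have f13 t : 0 <= hit heavy t <= 1 / 3.
  by rewrite hit_ge0 /=; have := hit_heavy_le t; have := small t; lra.
have := coverage_excess_le (enum 'I_T) f13; rewrite !sumE big_enum /=.
have : \sum_t hit heavy t ^+ 2 <= 9 * \sum_t loss q eff t ^+ 2.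
  rewrite mulr_sumr; apply: ler_sum => t _.
  by have := hit_heavy_le t; have := hit_ge0 heavy t; nra.
have := loss_le_gains.
by lra.
Qed.

End Analysis.

Theorem theorem5p4 (R : realType) (I J : finType) (T : nat)
    (W : adwords R I J T)
    (d : measure_display) (Omega : measurableType d) (P : probability Omega R)
    (arr : 'I_T -> Omega -> option I) (eta : 'I_T -> {RV P >-> R})
    (pick coin : 'I_T -> {RV P >-> bool})
    (rand : is_randomness W arr eta pick coin)
    (ord : seq J) (ord_enum : perm_eq ord (enum J))
    (mu : 'I_T -> I -> J -> R) (mu_ge0 : forall t i j, 0 <= mu t i j)
    (feasible : lp_feasible W P arr (fun t i j => arrival_prob W t i * mu t i j))
    (j : J) :
  ('E_P[fun w => pos_part
      (1 - allocated_bid W ord mu arr eta pick coin j w / budget W j)%R]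
    <= (socs_bound (fractional_load W mu j))%:E)%E.
Proof.
rewrite (expected_shortfallE rand ord_enum mu_ge0) lee_fin.
exact: (value_le_socs_bound rand ord_enum mu_ge0 j feasible).
Qed.
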